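(* Let $\mathcal G$ be an undirected and connected graph on $\mathcal V=\{1,\dots,n\}$ with adjacency matrix $[a_{i,j}]$, and let $A\in\mathbb R^{m\times m}$, $B\in\mathbb R^{r\times r}$, $C\in\mathbb R^{m\times r}$ be partitioned into blocks $A_i,B_i,C_i$ as described in the context. Consider the following dynamical system in the state $P_l=\mathrm{col}\{\bar X,Y,Z,W,\Lambda,\Upsilon,\Theta\}$, with arbitrary initial conditions $X_i(0),W_i(0),\Lambda_i(0),\Theta_i(0)\in\mathbb R^{m\times r}$, $Y_i(0),\Upsilon_i(0)\in\mathbb R^{m_i\times r}$, $Z_i(0)\in\mathbb R^{m\times r_i}$: for all $i\in\mathcal V$ and $t\ge 0$, $$\begin{aligned} \dot X_i&=-(X_iB_i-C_i+Z_i)B_i^T-A_i^T(A_iX_i-Y_i)-A_i^T\Upsilon_i-\sum_{j=1}^n a_{i,j}(\Lambda_i-\Lambda_j)-\sum_{j=1}^n a_{i,j}(X_i-X_j),\\ \dot Y_i&=\Upsilon_i-[I_{m_i}]_{\mathcal C}\Theta_i+A_iX_i-Y_i,\\ \dot Z_i&=-(X_iB_i-C_i+Z_i)+\Theta_i[I_{r_i}]_{\mathcal R},\\ \dot W_i&=\sum_{j=1}^n a_{i,j}(\Theta_i-\Theta_j),\\ \dot\Lambda_i&=\sum_{j=1}^n a_{i,j}(X_i-X_j),\\ \dot\Upsilon_i&=A_iX_i-Y_i,\\ \dot\Theta_i&=[Y_i]_{\mathcal R}-[Z_i]_{\mathcal C}-\sum_{j=1}^n a_{i,j}(W_i-W_j)-\sum_{j=1}^n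 a_{i,j}(\Theta_i-\Theta_j). \end{aligned}$$ Then: (i) every equilibrium of this system is Lyapunov stable and every solution is bounded; (ii) the system is globally semi-stable; moreover, the solution $P_l(t)$ with initial condition $P_l(0)$ converges exponentially to an equilibrium of the system; (iii) for every $i\in\mathcal V$, the limit $\lim_{t\to\infty}X_i(t)=X^*$ (the same $X^*$ for all $i$) is a least squares solution of the Sylvester equation $AX+XB=C$, i.e. a minimizer of $\|AX+XB-C\|_F^2$ over $X\in\mathbb R^{m\times r}$.
   Context: Graph: $\mathcal G$ has node set $\mathcal V=\{1,\dots,n\}$ and edge set $\mathcal E\subset\mathcal V\times\mathcal V$; its adjacency matrix satisfies $a_{i,j}=a_{j,i}>0$ if $(i,j)\in\mathcal E$ and $a_{i,j}=0$ otherwise. Partition: $m=\sum_{i=1}^n m_i$, $r=\sum_{i=1}^n r_i$ with positive integers $m_i,r_i$; $A=\mathrm{col}\{A_1,\dots,A_n\}$ with $A_i\in\mathbb R^{m_i\times m}$ (row blocks), $B=[B_1,\dots,B_n]$ with $B_i\in\mathbb R^{r\times r_i}$, $C=[C_1,\dots,C_n]$ with $C_i\in\mathbb R^{m\times r_i}$ (column blocks). Notation: $\mathrm{col}\{M_1,\dots,M_n\}=[M_1^T,\dots,M_n^T]^T$. $\|\cdot\|_F$ is the Frobenius norm. Variables: $X_i,W_i,\Lambda_i,\Theta_i\in\mathbb R^{m\times r}$, $Y_i,\Upsilon_i\in\mathbb R^{m_i\times r}$, $Z_i\in\mathbb R^{m\times r_i}$; $\bar X,W,\Lambda,\Theta\in\mathbb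 R^{mn\times r}$ are $\bar X=\mathrm{col}\{X_1,\dots,X_n\}$ and similarly for $W,\Lambda,\Theta$; $Y=\mathrm{col}\{Y_1,\dots,Y_n\}$, $\Upsilon=\mathrm{col}\{\Upsilon_1,\dots,\Upsilon_n\}\in\mathbb R^{m\times r}$; $Z=[Z_1,\dots,Z_n]\in\mathbb R^{m\times r}$. Augmented matrices: for a matrix $M$ with $m_i$ rows, $[M]_{\mathcal R}$ (with index $i$) is the matrix with $m$ rows partitioned into row blocks of sizes $m_1,\dots,m_n$ whose $i$-th row block is $M$ and whose other blocks are zero; for a matrix $M$ with $r_i$ columns, $[M]_{\mathcal C}$ is the matrix with $r$ columns partitioned into column blocks of sizes $r_1,\dots,r_n$ whose $i$-th column block is $M$ and whose other blocks are zero. For identity matrices the same convention gives $[I_{m_i}]_{\mathcal C}=[0_{m_i\times m_1},\dots,I_{m_i},\dots,0_{m_i\times m_n}]\in\mathbb R^{m_i\times m}$ and $[I_{r_i}]_{\mathcal R}=\mathrm{col}\{0_{r_1\times r_i},\dots,I_{r_i},\dots,0_{r_n\times r_i}\}\in\mathbb R^{r\times r_i}$ (identity in the $i$-th block). Semi-stability: a system $\dot x=\phi(x)$ on $\mathbb R^d$ is globally semi-stable if every solution, from any initial condition in $\mathbb R^d$, converges to a Lyapunov stable equilibrium. *)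

(* Defs.v *)
From HB Require Import structures.
From mathcomp Require Export all_boot all_order all_algebra.
From mathcomp Require Export all_classical all_reals all_analysis.
Export Order.TTheory GRing.Theory Num.Theory.
Export numFieldNormedType.Exports.

Set Implicit Arguments.
Unset Strict Implicit.
Unset Printing Implicit Defensive.

Global Open Scope classical_set_scope.
Global Open Scope ring_scope.

Section DynamicalSystems.
Context {R : realType} {V : normedModType R}.
Implicit Types (phi : V -> V) (x : R -> V) (xe : V).

(* Solutions live on [0, +oo[: the values of x at negative times are
   irrelevant, and the derivative at time 0 is the right derivative. *)
Definition is_solution phi x : Prop :=
  forall t : R, 0 <= t ->
    h^-1 *: (x (t + h) - x t) @[h --> within [set h | 0 <= t + h] 0^']
      --> phi (x t).

Definition is_equilibrium phi xe : Prop := phi xe = 0.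

(* On matrices `|.| is the entrywise maximum norm; in finite dimension the
   notions below do not depend on the choice of the norm. *)
Definition lyapunov_stable phi xe : Prop :=
  forall eps : R, 0 < eps -> exists2 delta : R, 0 < delta &
    forall x, is_solution phi x -> `|x 0 - xe| < delta ->
      forall t : R, 0 <= t -> `|x t - xe| < eps.

Definition bounded_trajectory x : Prop :=
  exists M : R, forall t : R, 0 <= t -> `|x t| <= M.

Definition globally_semistable phi : Prop :=
  forall x, is_solution phi x ->
    exists xe, [/\ is_equilibrium phi xe, lyapunov_stable phi xe
                 & x t @[t --> +oo] --> xe].

Definition converges_exponentially x xe : Prop :=
  exists c lambda : R, 0 < lambda /\
    forall t : R, 0 <= t -> `|x t - xe| <= c * expR (- (lambda * t)).

End DynamicalSystems.

Definition is_adjacency_matrix {R : realType} {n : nat}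
    (e : rel 'I_n) (a : 'M[R]_n) : Prop :=
  forall i j, (e i j -> a i j = a j i /\ 0 < a i j) /\
              (~~ e i j -> a i j = 0).

Definition frobenius_norm {R : realType} {p q : nat} (M : 'M[R]_(p, q)) : R :=
  Num.sqrt (\sum_i \sum_j M i j ^+ 2).

Definition is_least_squares_sylvester {R : realType} {m r : nat}
    (A : 'M[R]_m) (B : 'M[R]_r) (C : 'M[R]_(m, r)) (X : 'M[R]_(m, r)) : Prop :=
  forall X' : 'M[R]_(m, r),
    frobenius_norm (A *m X + X *m B - C) ^+ 2
      <= frobenius_norm (A *m X' + X' *m B - C) ^+ 2.

Section Augmented.
Context {R : realType} {n : nat} (p_ : 'I_n -> nat) {q : nat}.

Definition aug_row (i : 'I_n) (M : 'M[R]_(p_ i, q)) : 'M[R]_(\sum_j p_ j, q) :=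
  \mxcol_j eqtype.dfwith (fun j => 0 : 'M[R]_(p_ j, q)) M j.

Definition aug_col (i : 'I_n) (M : 'M[R]_(q, p_ i)) : 'M[R]_(q, \sum_j p_ j) :=
  \mxrow_j eqtype.dfwith (fun j => 0 : 'M[R]_(q, p_ j)) M j.

End Augmented.

Arguments aug_row {R n} p_ {q} i M.
Arguments aug_col {R n} p_ {q} i M.

Section SylvesterFlow.
Context {R : realType} {n : nat} (mi ri : 'I_n -> nat).

Local Notation m := (\sum_(i < n) mi i)%N.
Local Notation r := (\sum_(i < n) ri i)%N.
Local Notation nm := (\sum_(i < n) m)%N.

Definition state_rows : nat := nm + (m + (m + (nm + (nm + (m + nm))))).

Definition pack_state (X : 'M[R]_(nm, r)) (Y Z : 'M[R]_(m, r))
    (W L : 'M[R]_(nm, r)) (U : 'M[R]_(m, r)) (T : 'M[R]_(nm, r)) :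
    'M[R]_(state_rows, r) :=
  col_mx X (col_mx Y (col_mx Z (col_mx W (col_mx L (col_mx U T))))).

(* The blocks X_i, Y_i, Z_i, W_i, Lambda_i, Upsilon_i, Theta_i of
   P = col{X, Y, Z, W, Lambda, Upsilon, Theta}.  Z is cut by columns, all
   the other components by rows. *)
Section Blocks.
Variables (P : 'M[R]_(state_rows, r)) (i : 'I_n).

Definition block_X : 'M[R]_(m, r) :=
  @submxcol _ n (fun=> m) r (usubmx P) i.
Definition block_Y : 'M[R]_(mi i, r) :=
  submxcol (usubmx (dsubmx P)) i.
Definition block_Z : 'M[R]_(m, ri i) :=
  submxrow (usubmx (dsubmx (dsubmx P))) i.
Definition block_W : 'M[R]_(m, r) :=
  @submxcol _ n (fun=> m) r (usubmx (dsubmx (dsubmx (dsubmx P)))) i.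
Definition block_Lambda : 'M[R]_(m, r) :=
  @submxcol _ n (fun=> m) r
    (usubmx (dsubmx (dsubmx (dsubmx (dsubmx P))))) i.
Definition block_Upsilon : 'M[R]_(mi i, r) :=
  submxcol (usubmx (dsubmx (dsubmx (dsubmx (dsubmx (dsubmx P)))))) i.
Definition block_Theta : 'M[R]_(m, r) :=
  @submxcol _ n (fun=> m) r
    (dsubmx (dsubmx (dsubmx (dsubmx (dsubmx (dsubmx P)))))) i.

End Blocks.

Variables (a : 'M[R]_n) (A : 'M[R]_m) (B : 'M[R]_r) (C : 'M[R]_(m, r)).

Definition sylvester_field (P : 'M[R]_(state_rows, r)) :
    'M[R]_(state_rows, r) :=
  let A_ i := submxcol A i in
  let B_ i := submxrow B i in
  let C_ i := submxrow C i in
  let X := block_X P in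
  let Y := block_Y P in
  let Z := block_Z P in
  let W := block_W P in
  let Lambda := block_Lambda P in
  let Upsilon := block_Upsilon P in
  let Theta := block_Theta P in
  pack_state
    (\mxcol_(i < n)
      (- ((X i *m B_ i - C_ i + Z i) *m (B_ i)^T)
       - (A_ i)^T *m (A_ i *m X i - Y i)
       - (A_ i)^T *m Upsilon i
       - \sum_j a i j *: (Lambda i - Lambda j)
       - \sum_j a i j *: (X i - X j)))
    (\mxcol_i
      (Upsilon i - aug_col mi i 1%:M *m Theta i
       + A_ i *m X i - Y i))
    (\mxrow_i
      (- (X i *m B_ i - C_ i + Z i)
       + Theta i *m aug_row ri i 1%:M))
    (\mxcol_(i < n) \sum_j a i j *: (Theta i - Theta j))
    (\mxcol_(i < n) \sum_j a i j *: (X i - X j))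
    (\mxcol_i (A_ i *m X i - Y i))
    (\mxcol_(i < n)
      (aug_row mi i (Y i) - aug_col ri i (Z i)
       - \sum_j a i j *: (W i - W j)
       - \sum_j a i j *: (Theta i - Theta j))).

End SylvesterFlow.

(* Main.v *)
Require Import Defs.
From HB Require Import structures.
From mathcomp Require Import ring lra.

Set Implicit Arguments.
Unset Strict Implicit.
Unset Printing Implicit Defensive.

(** The system is affine, [P' = f P + b], and splits as a saddle-point flow: for
the entrywise inner product of states, its linear part [f] is minus a positive
semidefinite map (the Hessian of a convex augmented Lagrangian in the primal
variables X, Y, Z, W, and the Laplacian damping of Theta) plus a skew map (the
primal-dual coupling).  The skew part cancels in [<f P, P>], which leaves

  [<f P, P> = - (sum_i |X_i B_i + Z_i|^2 + sum_i |A_i X_i - Y_i|^2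
               + <L X, X> + <L Theta, Theta>)],

where L is the graph Laplacian ([sylvester_energy]).

Everything about the flow follows from this dissipativity and two facts of
linear algebra about [f].

Existence of equilibria: for a dissipative map the kernels of [f] and of its
adjoint coincide, so [b] is in the range of [f] as soon as it is orthogonal to
the kernel.  It is, because [<b, P> = sum_i <C_i, X_i B_i + Z_i>], and the
terms [X_i B_i + Z_i] vanish on the kernel by the energy identity
([sylvester_forcing_orth]).

Exclusion of oscillations: if [P], [f P], [f (f P)] and [f (f (f P))] all have
zero energy, then the last of them is zero ([sylvester_observable]).  Indeed,
zero energy of [P] freezes W, Lambda and Upsilon; next X vanishes, then Y and Z,
then Theta.  Since dissipativity makes the iterated kernels of [f] equal to its
kernel, a trajectory that never loses energy is constant.

The theorem for general dissipative affine flows goes as follows.  The squared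
distance to any equilibrium decreases along solutions, which gives Lyapunov
stability.  Observability is upgraded to a rate by a strict Lyapunov form
([strict_lyapunov_form]): to the square of the norm one adds small multiples of
the cross terms [- <x M^k S, x M^(k+1) S>], where S is twice the symmetric part
of the matrix M of [f].  The derivative of such a term contains
[- |x M^(k+1) S|^2] and an error controlled by the two neighbouring levels, so
an elimination from the top level down makes the total derivative negative
definite on the range of M.  The error [P t - Pe] stays in this range when the
equilibrium [Pe] is chosen so that it starts there
([dissipative_ker_add_range]), hence it decays exponentially.

At an equilibrium the Laplacian terms force consensus of the X_i and of the
Theta_i.  Summing the X and Theta equations over the nodes cancels the remaining
Laplacians; with the Z equations it identifies the common Theta with the residual
[E = A X + X B - C] and turns the X equations into the normal equation
[A^T E + E B^T = 0], which characterizes least squares solutions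
([sylvester_equilibrium_least_squares]). *)

(** * The entrywise inner product of matrices *)
Section InnerProduct.
Context {R : realFieldType}.

Definition mxdot p q (P Q : 'M[R]_(p, q)) : R := \sum_i \sum_j P i j * Q i j.

Lemma mxdotC p q (P Q : 'M[R]_(p, q)) : mxdot P Q = mxdot Q P.
Proof. by apply: eq_bigr => i _; apply: eq_bigr => j _; rewrite mulrC. Qed.

Lemma mxdotDl p q (P P' Q : 'M[R]_(p, q)) :
  mxdot (P + P') Q = mxdot P Q + mxdot P' Q.
Proof.
rewrite -big_split; apply: eq_bigr => i _; rewrite -big_split.
by apply: eq_bigr => j _; rewrite mxE mulrDl.
Qed.

Lemma mxdotZl p q k (P Q : 'M[R]_(p, q)) : mxdot (k *: P) Q = k * mxdot P Q.
Proof.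
rewrite mulr_sumr; apply: eq_bigr => i _; rewrite mulr_sumr.
by apply: eq_bigr => j _; rewrite mxE mulrA.
Qed.

Lemma mxdotNl p q (P Q : 'M[R]_(p, q)) : mxdot (- P) Q = - mxdot P Q.
Proof. by rewrite -scaleN1r mxdotZl mulN1r. Qed.

Lemma mxdotBl p q (P P' Q : 'M[R]_(p, q)) :
  mxdot (P - P') Q = mxdot P Q - mxdot P' Q.
Proof. by rewrite mxdotDl mxdotNl. Qed.

Lemma mxdot0l p q (Q : 'M[R]_(p, q)) : mxdot 0 Q = 0.
Proof. by rewrite -(scale0r 0) mxdotZl mul0r. Qed.

Lemma mxdot_suml p q n (F : 'I_n -> 'M[R]_(p, q)) Q :
  mxdot (\sum_i F i) Q = \sum_i mxdot (F i) Q.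
Proof.
elim/big_ind2: _ => [|P x P' y <- <-|//]; first exact: mxdot0l.
exact: mxdotDl.
Qed.

Lemma mxdotDr p q (Q P P' : 'M[R]_(p, q)) :
  mxdot Q (P + P') = mxdot Q P + mxdot Q P'.
Proof. by rewrite mxdotC mxdotDl !(mxdotC Q). Qed.

Lemma mxdotZr p q k (P Q : 'M[R]_(p, q)) : mxdot P (k *: Q) = k * mxdot P Q.
Proof. by rewrite mxdotC mxdotZl mxdotC. Qed.

Lemma mxdotNr p q (P Q : 'M[R]_(p, q)) : mxdot P (- Q) = - mxdot P Q.
Proof. by rewrite mxdotC mxdotNl mxdotC. Qed.

Lemma mxdotBr p q (Q P P' : 'M[R]_(p, q)) :
  mxdot Q (P - P') = mxdot Q P - mxdot Q P'.
Proof. by rewrite mxdotDr mxdotNr. Qed.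

Lemma mxdot0r p q (P : 'M[R]_(p, q)) : mxdot P 0 = 0.
Proof. by rewrite mxdotC mxdot0l. Qed.

Lemma mxdot_ge0 p q (P : 'M[R]_(p, q)) : 0 <= mxdot P P.
Proof.
by apply: sumr_ge0 => i _; apply: sumr_ge0 => j _; rewrite -expr2 sqr_ge0.
Qed.

Lemma sqr_entry_le_mxdot p q (P : 'M[R]_(p, q)) i j : P i j ^+ 2 <= mxdot P P.
Proof.
rewrite /mxdot (bigD1 i) //= (bigD1 j) //= -expr2 -addrA lerDl addr_ge0 //.
  by apply: sumr_ge0 => k _; rewrite -expr2 sqr_ge0.
by apply: sumr_ge0 => k _; apply: sumr_ge0 => l _; rewrite -expr2 sqr_ge0.
Qed.

Lemma mxdot_eq0 p q (P : 'M[R]_(p, q)) : mxdot P P <= 0 -> P = 0.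
Proof.
move=> P0; apply/matrixP => i j; rewrite mxE; apply/eqP; rewrite -sqrf_eq0.
by rewrite eq_le sqr_ge0 (le_trans (sqr_entry_le_mxdot P i j)).
Qed.

Lemma sum_mxdot_eq0 n (p_ q_ : 'I_n -> nat) (F : forall i, 'M[R]_(p_ i, q_ i)) :
  \sum_i mxdot (F i) (F i) = 0 -> forall i, F i = 0.
Proof.
move=> /eqP; rewrite psumr_eq0 => [/allP F0 i|i _]; last exact: mxdot_ge0.
by apply: mxdot_eq0; have /eqP -> := F0 i (mem_index_enum _).
Qed.

Lemma mxdotE p q (P Q : 'M[R]_(p, q)) : mxdot P Q = \tr (P *m Q^T).
Proof.
by apply: eq_bigr => i _; rewrite mxE; apply: eq_bigr => j _; rewrite mxE.
Qed.

Lemma mxdot_mulmxr p q s (P : 'M[R]_(p, q)) (F : 'M[R]_(q, s)) Q :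
  mxdot (P *m F) Q = mxdot P (Q *m F^T).
Proof. by rewrite !mxdotE trmx_mul trmxK mulmxA. Qed.

Lemma mxdot_mulmxl p q s (F : 'M[R]_(p, q)) (P : 'M[R]_(q, s)) Q :
  mxdot (F *m P) Q = mxdot P (F^T *m Q).
Proof. by rewrite !mxdotE -mulmxA mxtrace_mulC trmx_mul trmxK mulmxA. Qed.

Lemma mxdot_col_mx p1 p2 q (P1 Q1 : 'M[R]_(p1, q)) (P2 Q2 : 'M[R]_(p2, q)) :
  mxdot (col_mx P1 P2) (col_mx Q1 Q2) = mxdot P1 Q1 + mxdot P2 Q2.
Proof. by rewrite !mxdotE tr_col_mx mul_col_row mxtrace_block. Qed.

Lemma mxdot_mxrow p n (q_ : 'I_n -> nat) (P Q : forall i, 'M[R]_(p, q_ i)) :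
  mxdot (\mxrow_i P i) (\mxrow_i Q i) = \sum_i mxdot (P i) (Q i).
Proof.
rewrite mxdotE tr_mxrow mul_mxrow_mxcol raddf_sum.
by apply: eq_bigr => i _; rewrite mxdotE.
Qed.

Lemma mxdot_trmx p q (P Q : 'M[R]_(p, q)) : mxdot P^T Q^T = mxdot P Q.
Proof. by rewrite !mxdotE trmxK mxtrace_mulC -mxtrace_tr trmx_mul trmxK. Qed.

Lemma mxdot_mxcol q n (p_ : 'I_n -> nat) (P Q : forall i, 'M[R]_(p_ i, q)) :
  mxdot (\mxcol_i P i) (\mxcol_i Q i) = \sum_i mxdot (P i) (Q i).
Proof.
rewrite -mxdot_trmx !tr_mxcol mxdot_mxrow.
by apply: eq_bigr => i _; rewrite mxdot_trmx.
Qed.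

(** The discriminant criterion is stated for a quadratic that may degenerate,
so that it yields the Cauchy-Schwarz inequality for semidefinite forms too. *)
Lemma discriminant_le (a b c : R) :
  0 <= c -> (forall t, 0 <= a + b * t *+ 2 + c * t ^+ 2) -> b ^+ 2 <= a * c.
Proof.
move=> cge H; have [c0|c0] := eqVneq c 0.
  move: H; rewrite c0 mulr0 => H; have [->|b0] := eqVneq b 0.
    by rewrite expr0n.
  (* An affine function of [t] is negative somewhere unless it is constant. *)
  have := H (- (a + 1) / (b *+ 2)).
  suff -> : a + b * (- (a + 1) / (b *+ 2)) *+ 2 + 0 * (- (a + 1) / (b *+ 2)) ^+ 2
    = -1 by rewrite lerNr oppr0 ler10.
  by field.
have cp : 0 < c by rewrite lt_neqAle eq_sym c0.
have := H (- b / c).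
have -> : a + b * (- b / c) *+ 2 + c * (- b / c) ^+ 2 = (a * c - b ^+ 2) / c by field.
by rewrite pmulr_lge0 ?invr_gt0 // subr_ge0.
Qed.

Lemma mxdot_cauchy_schwarz p q (P Q : 'M[R]_(p, q)) :
  mxdot P Q ^+ 2 <= mxdot P P * mxdot Q Q.
Proof.
apply: discriminant_le; first exact: mxdot_ge0.
move=> t; have := mxdot_ge0 (P + t *: Q).
rewrite mxdotDl !mxdotDr !mxdotZr !mxdotZl (mxdotC Q P).
by congr (_ <= _); ring.
Qed.

Lemma mxdot_mulmx_le p q s (P : 'M[R]_(p, q)) (F : 'M[R]_(q, s)) :
  mxdot (P *m F) (P *m F) <= mxdot P P * mxdot F F.
Proof.
rewrite [X in X <= _]/mxdot [X in _ <= X * _]/mxdot mulr_suml; apply: ler_sum => i _.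
rewrite -[mxdot F F]mxdot_trmx [X in _ <= _ * X]/mxdot mulr_sumr.
apply: ler_sum => j _; rewrite -expr2.
have := mxdot_cauchy_schwarz (row i P) (row j F^T).
have rowE m n (A : 'M[R]_(m, n)) k l (B : 'M[R]_(l, n)) k' :
    mxdot (row k A) (row k' B) = \sum_h A k h * B k' h.
  by rewrite /mxdot big_ord1; apply: eq_bigr => h _; rewrite !mxE.
rewrite !rowE mxE => /(le_trans _); apply.
rewrite le_eqVlt; apply/orP; left; apply/eqP; congr (_ ^+ 2).
by apply: eq_bigr => h _; rewrite mxE.
Qed.

(** An inclusion of kernels becomes a norm inequality because [G] factors
through [F], as [G = F (F^+ G)] with a partial inverse [F^+] of [F].  This
replaces the usual compactness argument on the unit sphere. *)
Lemma kernel_sub_mxdot_le d s1 s2 (F : 'M[R]_(d, s1)) (G : 'M[R]_(d, s2)) :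
  (forall x : 'rV_d, x *m F = 0 -> x *m G = 0) ->
  exists2 c, 0 <= c & forall x : 'rV_d,
    mxdot (x *m G) (x *m G) <= c * mxdot (x *m F) (x *m F).
Proof.
move=> FG; exists (mxdot (pinvmx F *m G) (pinvmx F *m G)).
  exact: mxdot_ge0.
move=> x; rewrite mulrC; suff -> : x *m G = x *m F *m (pinvmx F *m G).
  exact: mxdot_mulmx_le.
apply/eqP; rewrite -subr_eq0 (mulmxA (x *m F)) -mulmxBl; apply/eqP/FG.
by rewrite mulmxBl mulmxKpV ?subrr // submxMl.
Qed.

End InnerProduct.

(** * Strict Lyapunov forms for dissipative matrices *)

(** For [x] in the kernel, [<(y + t x) M, y + t x>] is affine in [t] with slope
[<y M, x>]; being bounded above it has slope zero for every [y], and the slope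
is [<y, x M^T>]. *)
Lemma dissipative_ker_tr (R : realFieldType) d (M : 'M[R]_d) (x : 'rV_d) :
  (forall x : 'rV_d, mxdot (x *m M) x <= 0) -> x *m M = 0 -> x *m M^T = 0.
Proof.
move=> dissipative xM0; apply: mxdot_eq0.
have M0 y : mxdot (y *m M) x <= 0.
  have : forall t, 0 <= - mxdot (y *m M) y + t * (- mxdot (y *m M) x).
    move=> t; have := dissipative (y + t *: x).
    rewrite mulmxDl -scalemxAl xM0 scaler0 addr0 mxdotDr mxdotZr; lra.
  set a := - mxdot _ y; set b := - mxdot _ x => H.
  suff : 0 <= b by rewrite /b oppr_ge0.
  rewrite leNgt; apply/negP => bn; have := H (- (a + 1) / b).
  by rewrite divfK ?lt_eqF //; lra.
by have := M0 (x *m M^T); rewrite mxdot_mulmxr.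
Qed.

Section StrictLyapunov.
Context {R : realFieldType} (d : nat) (M : 'M[R]_d) (K : nat).
Hypothesis dissipative : forall x : 'rV_d, mxdot (x *m M) x <= 0.

(** [|x M|^2 = <x, x M M^T>], and [x M] lies in the common kernel of [M] and
[M^T]. *)
Lemma dissipative_ker_sqr (x : 'rV_d) : x *m M *m M = 0 -> x *m M = 0.
Proof.
move=> /(dissipative_ker_tr dissipative) xMM; apply: mxdot_eq0.
by rewrite mxdot_mulmxr xMM mxdot0r.
Qed.

Lemma dissipative_ker_exp k (x : 'rV_d) : x *m M ^+ k = 0 -> x *m M = 0.
Proof.
elim: k => [|k IHk]; first by rewrite expr0 mulmx1 => ->; rewrite mul0mx.
case: k IHk => [|k] IHk; first by rewrite expr1.
rewrite 2!exprSr -!mulmxE !mulmxA => /dissipative_ker_sqr.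
by rewrite -mulmxA mulmxE -exprSr.
Qed.

(** Fredholm alternative: the range of [M] is the orthogonal of the kernel of
[M^T], which is the kernel of [M]. *)
Lemma dissipative_range (b : 'rV_d) :
  (forall x : 'rV_d, x *m M = 0 -> mxdot b x = 0) ->
  exists y, y *m M = b.
Proof.
move=> bM; suff /submxP[y ->] : (b <= M)%MS by exists y.
rewrite submxE; apply/eqP/rowP => j; rewrite mxE.
have : (row j (cokermx M)^T) *m M = 0.
  set w := row j _; rewrite -[M]trmxK; apply: dissipative_ker_tr => [x|].
    by rewrite mxdot_mulmxr trmxK mxdotC.
  by rewrite /w -row_mul -trmx_mul mulmx_coker trmx0 row0.
move=> /bM; rewrite /mxdot big_ord1 => bw; rewrite mxE -[RHS]bw.
by apply: eq_bigr => k _; rewrite !mxE.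
Qed.

(** Kernel and range of [M] meet trivially since [M] and its square have the
same kernel; hence they span by a dimension count. *)
Lemma dissipative_ker_add_range (x : 'rV_d) :
  exists2 u : 'rV_d, u *m M = 0 & exists y, x = u + y *m M.
Proof.
have cap0 : (M :&: kermx M)%MS = 0.
  apply/eqP/rowV0P => v; rewrite sub_capmx => /andP[/submxP[y ->] /sub_kermxP].
  exact: dissipative_ker_sqr.
have : (M <= M *m M)%MS.
  have [_ <-] := mxrank_leqif_sup (submxMl M M).
  by rewrite -(mxrank_mul_ker M M) cap0 mxrank0 addn0.
move=> /(submx_trans (submxMl x M)) /submxP[y xM].
exists (x - y *m M); first by rewrite mulmxBl -mulmxA -xM subrr.
by exists y; rewrite subrK.
Qed.

(** Twice the symmetric part, which spares a division. *)
Definition sym_part : 'M[R]_d := M + M^T.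

Lemma mxdot_sym_part (x : 'rV_d) : mxdot (x *m sym_part) x = 2 * mxdot (x *m M) x.
Proof.
by rewrite mulmxDr mxdotDl [X in _ + X]mxdot_mulmxr trmxK (mxdotC x) -mulr2n mulr_natl.
Qed.

(** The Cauchy-Schwarz inequality of the semidefinite form
[- <x S, y>], applied to [x] and [x S]: a vector that dissipates little is
nearly annihilated by [S]. *)
Lemma sym_part_le : exists2 c, 0 <= c & forall x : 'rV_d,
  mxdot (x *m sym_part) (x *m sym_part) <= c * - mxdot (x *m M) x.
Proof.
pose S := sym_part; have St : S^T = S by rewrite /S /sym_part linearD /= trmxK addrC.
have s0 (y : 'rV_d) : 0 <= - mxdot (y *m S) y.
  by rewrite /S mxdot_sym_part oppr_ge0 pmulr_rle0.
have s1 (y : 'rV_d) : - mxdot (y *m S) y <= (mxdot S S + 1) * mxdot y y.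
  have := mxdot_ge0 (y *m S + y); have := mxdot_mulmx_le y S.
  have := mxdot_ge0 (y *m S); have := s0 y; have := mxdot_ge0 y.
  rewrite !mxdotDl !mxdotDr (mxdotC y); set a := mxdot (y *m S) _; nra.
exists ((mxdot S S + 1) *+ 2).
  by rewrite mulrn_wge0 // addr_ge0 // mxdot_ge0.
move=> x; have S0 := mxdot_ge0 S.
have [xS0|xS0] := eqVneq (mxdot (x *m S) (x *m S)) 0.
  by rewrite -/S xS0 mulr_ge0 ?mulrn_wge0 ?addr_ge0 ?oppr_ge0.
have xSp : 0 < mxdot (x *m S) (x *m S) by rewrite lt_neqAle eq_sym xS0 mxdot_ge0.
have : mxdot (x *m S) (x *m S) ^+ 2 <=
    - mxdot (x *m S) x * - mxdot (x *m S *m S) (x *m S).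
  apply: discriminant_le => // t.
  have := s0 (x - t *: (x *m S)).
  rewrite mulmxBl -scalemxAl !mxdotBl !mxdotBr !mxdotZr !mxdotZl.
  rewrite (mxdot_mulmxr (x *m S) S x) St.
  by congr (_ <= _); ring.
move=> /le_trans /(_ (ler_wpM2l (s0 x) (s1 _))).
rewrite [in X in _ <= X -> _]/S mxdot_sym_part mulrA expr2 ler_pM2r // => /le_trans; apply.
by rewrite le_eqVlt; apply/orP; left; apply/eqP; ring.
Qed.

Let S := sym_part.
Let h k (x : 'rV_d) := mxdot (x *m M ^+ k *m S) (x *m M ^+ k *m S).

Definition qform (Q : 'M[R]_d) (x : 'rV_d) : R := mxdot (x *m Q) x.
(** The derivative of [qform Q] along [x' = x M], see [qform_dotE]. *)
Definition qform_dot (Q : 'M[R]_d) := qform (M *m Q + Q *m M^T).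

Lemma qform_dotE Q (x : 'rV_d) :
  qform_dot Q x = mxdot (x *m M *m Q) x + mxdot (x *m Q) (x *m M).
Proof.
by rewrite /qform_dot /qform mulmxDr mxdotDl !mulmxA [X in _ + X]mxdot_mulmxr trmxK.
Qed.

Lemma qformD P Q x : qform (P + Q) x = qform P x + qform Q x.
Proof. by rewrite /qform mulmxDr mxdotDl. Qed.

Lemma qformZ c Q x : qform (c *: Q) x = c * qform Q x.
Proof. by rewrite /qform -scalemxAr mxdotZl. Qed.

Lemma qform_dotD P Q x : qform_dot (P + Q) x = qform_dot P x + qform_dot Q x.
Proof. by rewrite !qform_dotE !mulmxDr !mxdotDl; ring. Qed.

Lemma qform_dotZ c Q x : qform_dot (c *: Q) x = c * qform_dot Q x.
Proof. by rewrite !qform_dotE -!scalemxAr !mxdotZl; ring. Qed.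

Lemma qform_norm_le Q x : `|qform Q x| <= (mxdot Q Q + 1) * mxdot x x.
Proof.
have := mxdot_mulmx_le x Q; have Q0 := mxdot_ge0 Q; have x0 := mxdot_ge0 x.
have := mxdot_ge0 (x *m Q + x); have := mxdot_ge0 (x *m Q - x).
rewrite /qform !mxdotDl !mxdotDr !mxdotNl !mxdotNr (mxdotC x).
have := mxdot_ge0 (x *m Q).
set a := mxdot (x *m Q) _; set b := mxdot (x *m Q) x => a0 H1 H2 H3.
by rewrite ler_norml; apply/andP; split; nra.
Qed.

(** The hypocoercive cross term, which pairs two consecutive levels [x M^k S]. *)
Let cross k := (M ^+ k *m S) *m (M ^+ k.+1 *m S)^T.

(** The cross term at level [k] produces the dissipation of level [k + 1], up
to an error that involves the levels [k] and [k + 2] only. *)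
Lemma cross_dot k (x : 'rV_d) : qform_dot (cross k) x =
  h k.+1 x + mxdot (x *m M ^+ k *m S) (x *m M ^+ k.+2 *m S).
Proof.
have crossE (y z : 'rV_d) : mxdot (y *m cross k) z =
    mxdot (y *m M ^+ k *m S) (z *m M ^+ k.+1 *m S).
  by rewrite /cross mulmxA mxdot_mulmxr trmxK !mulmxA.
rewrite qform_dotE !crossE /h.
by rewrite !exprS -!mulmxE !mulmxA.
Qed.

Let total x := \sum_(j < K.+1) h j x.

Let h_ge0 k x : 0 <= h k x.
Proof. exact: mxdot_ge0. Qed.

(** Elimination of the levels from the top: each step doubles the current form
and subtracts the cross term below the highest remaining level, whose
dissipation absorbs that level.  Half of [total x] pays for the error term, the
rest of which falls on lower levels.  The hypothesis on level [K + 1] closes the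
hierarchy. *)
Lemma hypocoercive_descent c0 i : 0 <= c0 ->
  (forall x, h K.+1 x <= c0 * total x) -> (i <= K)%N ->
  exists Q : 'M[R]_d, exists2 c, 0 <= c & forall x,
    total x - c * \sum_(j < K.+1 - i) h j x <= - qform_dot Q x.
Proof.
move=> c00 hK; elim: i => [_|i IHi iK].
  exists 0, 1 => // x; rewrite subn0 mul1r subrr qform_dotE.
  by rewrite !mulmx0 !mxdot0l addr0 oppr0.
have [Q [c cge0 IHQ]] := IHi (ltnW iK).
rewrite subSS; have : exists k, (K - i = k.+1)%N.
  by exists (K - i).-1; rewrite prednK // subn_gt0.
case=> k Ki; have Ki' : (K.+1 - i = k.+2)%N by rewrite subSn ?Ki // ltnW.
rewrite {}Ki' in IHQ; rewrite Ki.
(* The cross term is weighted so that its dissipation [2 c |x M^(k+1) S|^2]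
   cancels the level being eliminated; the second part of the new constant comes
   from the inequality between [2 c <u, v>] and the squares of [u] and [v]. *)
exists (2 *: Q + (- (2 * c)) *: cross k), (2 * c + c ^+ 2 * (c0 + 1)).
  by nra.
move=> x; have := IHQ x; rewrite big_ord_recr /=.
rewrite qform_dotD !qform_dotZ cross_dot.
have : h k x <= \sum_(j < k.+1) h j x.
  by rewrite big_ord_recr /= lerDr sumr_ge0.
have hk2 : h k.+2 x <= (c0 + 1) * total x.
  have T0 : 0 <= total x by apply: sumr_ge0.
  have [kK|kK] := ltnP k.+1 K; last first.
    have -> : k.+2 = K.+1.
      by apply/eqP; rewrite eqn_leq !ltnS kK -Ki leq_subr.
    by apply: le_trans (hK x) _; rewrite mulrDl lerDl mul1r.
  have : h k.+2 x <= total x.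
    have kK' : (k.+2 < K.+1)%N by [].
    by rewrite /total (bigD1 (Ordinal kK')) //= lerDl sumr_ge0.
  by nra.
set a := h k x; set b := \sum_(_ < _) _; set p := mxdot _ _.
have : 0 <= c ^+ 2 * (c0 + 1) * a + 2 * c * p + total x.
  (* Expand [|c (c0 + 1) u + v|^2 >= 0], then divide by [c0 + 1]. *)
  have s0 : 0 < c0 + 1 by lra.
  rewrite -(pmulr_rge0 _ s0).
  have := mxdot_ge0 ((c * (c0 + 1)) *: (x *m M ^+ k *m S) + x *m M ^+ k.+2 *m S).
  rewrite !mxdotDl !mxdotDr !mxdotZr !mxdotZl.
  rewrite (mxdotC (x *m M ^+ k.+2 *m S)) -/p -/(h k x) -/(h k.+2 x) -/a.
  by nra.
move=> H1 ab H2.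
have : 0 <= c ^+ 2 * (c0 + 1) * (b - a).
  by rewrite mulr_ge0 ?subr_ge0 // mulr_ge0 ?sqr_ge0 // addr_ge0.
move: H1 H2; set t := total x; set g := h k.+1 x; set D := qform_dot _ _; nra.
Qed.

(** Observability says that the levels [|x M^k S|], for [k <= K], control
[x M]; on the range of [M] they control the norm, since [M] and its square have
the same kernel.  A large multiple of the square of the norm makes the form
definite and pays for level 0, which is left over by the descent. *)
Lemma strict_lyapunov_form :
  (forall x : 'rV_d,
     (forall k, (k <= K)%N -> mxdot (x *m M ^+ k *m M) (x *m M ^+ k) = 0) ->
     x *m M ^+ K = 0) ->
  exists Q : 'M[R]_d, exists2 l, 0 < l &
    (forall x : 'rV_d, mxdot x x <= qform Q x) /\
    (forall y : 'rV_d, qform_dot Q (y *m M) <= - l * qform Q (y *m M)).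
Proof.
move=> obs.
have hobs (x : 'rV_d) : (forall k, (k <= K)%N -> x *m M ^+ k *m S = 0) -> x *m M = 0.
  move=> xS; apply: (@dissipative_ker_exp K); apply: obs => k kK.
  apply/eqP; have /eqP := mxdot_sym_part (x *m M ^+ k).
  by rewrite xS // mxdot0l eq_sym mulf_eq0 pnatr_eq0.
pose F (j : 'I_K.+1) := M ^+ j *m S.
have FE (x : 'rV_d) : mxdot (x *m \mxrow_j F j) (x *m \mxrow_j F j) = total x.
  by rewrite mul_mxrow mxdot_mxrow; apply: eq_bigr => j _; rewrite mulmxA.
have F0 (x : 'rV_d) : x *m \mxrow_j F j = 0 -> x *m M = 0.
  move=> xF0; apply: hobs => k kK; have kK' : (k < K.+1)%N by [].
  have := congr1 (fun B => submxrow B (Ordinal kK')) xF0.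
  by rewrite mul_mxrow mxrowK submxrow0 mulmxA.
have [c0 c00 hK] : exists2 c, 0 <= c & forall x, h K.+1 x <= c * total x.
  have [|c c0 H] := kernel_sub_mxdot_le (F := \mxrow_j F j) (G := M ^+ K.+1 *m S).
    by move=> x /F0 xM; rewrite exprS -mulmxE !mulmxA xM !mul0mx.
  by exists c => // x; have := H x; rewrite FE mulmxA.
have [c1 c10 hM] : exists2 c, 0 <= c & forall y : 'rV_d,
    mxdot (y *m M) (y *m M) <= c * total (y *m M).
  have [|c c1 H] := kernel_sub_mxdot_le (F := M *m \mxrow_j F j) (G := M).
    by move=> x; rewrite mulmxA => /F0 /dissipative_ker_sqr.
  by exists c => // x; have := H x; rewrite mulmxA FE.
have [Q0 [c cge0 HQ0]] := hypocoercive_descent c00 hK (leqnn K).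
have [c2 c20 HS] := sym_part_le.
pose w := mxdot Q0 Q0 + 1; have w0 : 0 < w by rewrite ltr_wpDl ?mxdot_ge0.
(* [w] bounds the form given by the descent, and [c c2] pays for level 0. *)
pose g := c * c2 + w + 1.
have g0 : 0 < g by rewrite /g; nra.
have one_qform (x : 'rV_d) : qform 1%:M x = mxdot x x.
  by rewrite /qform mulmx1.
have QE (x : 'rV_d) : qform (Q0 + g *: 1%:M) x = qform Q0 x + g * mxdot x x.
  by rewrite qformD qformZ one_qform.
exists (Q0 + g *: 1%:M), ((c1 + 1)^-1 * (w + g)^-1).
  by rewrite mulr_gt0 // invr_gt0; nra.
have Qlow (x : 'rV_d) := conj (qform_norm_le Q0 x) (mxdot_ge0 x).
split=> [x|y].
  rewrite QE; have [] := Qlow x; rewrite ler_norml -/w => /andP[H _] x0.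
  have := mulr_ge0 (mulr_ge0 cge0 c20) x0; rewrite /g.
  by move: H; set z := mxdot x x; set q := qform Q0 x; clearbody w; lra.
set x := y *m M.
have [] := Qlow x; rewrite ler_norml -/w => /andP[_ H] x0.
have := HQ0 x; rewrite subSnn big_ord1 => H1.
have H2 : h 0 x <= c2 * - mxdot (x *m M) x.
  by have := HS x; rewrite /h expr0 mulmx1.
have H3 := hM y; rewrite -/x in H3.
have xM := dissipative x.
have H4 : qform_dot (Q0 + g *: 1%:M) x <= - total x.
  rewrite qform_dotD qform_dotZ [qform_dot 1%:M _]qform_dotE !mulmx1.
  rewrite (mxdotC x) /g; move: H1 H2; set u := mxdot (x *m M) x => H1 H2.
  have u0 : 0 <= - u by rewrite oppr_ge0.
  have := ler_wpM2l cge0 H2; have := mulr_ge0 (mulr_ge0 cge0 c20) u0.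
  have := mulr_ge0 (ltW w0) u0.
  move: H1; set z := qform_dot _ _; clearbody w z u; rewrite /total.
  set t := \sum_(_ < _) _; lra.
have c1p : 0 < c1 + 1 by lra.
have wp : 0 < w + g by lra.
apply: le_trans H4 _; rewrite mulNr lerN2.
rewrite -mulrA ler_pdivrMl // ler_pdivrMl // QE.
have T0 : 0 <= total x by apply: sumr_ge0.
by nra.
Qed.
End StrictLyapunov.

(** * Derivatives on the closed half-line *)
Section HalfLineDerivative.
Context {R : realType}.
Implicit Types (f g : R -> R) (t l k : R).

Definition admissible_step t : set_system R :=
  within [set h : R | 0 <= t + h] 0^'.

(** The scalar form of the derivative in [is_solution]: two-sided at [t > 0] and
one-sided at [0], so that the rules of calculus hold uniformly on the closed
half-line. *)
Definition half_line_derive f t l : Prop :=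
  h^-1 * (f (t + h) - f t) @[h --> admissible_step t] --> l.

#[local] Instance admissible_step_filter t : Filter (admissible_step t).
Proof. exact: within_filter. Qed.

Lemma admissible_step_neq0 t : \forall h \near admissible_step t, h != 0.
Proof.
rewrite /admissible_step near_withinE; near=> h => _.
near: h; exact: nbhs_dnbhs_neq.
Unshelve. all: by end_near. Qed.

Lemma admissible_step_cvg0 t : h @[h --> admissible_step t] --> (0 : R).
Proof.
apply: cvg_trans (@nbhs_dnbhs _ (0 : R)).
exact: cvg_within.
Qed.

Lemma half_line_derive_continuous f t l : half_line_derive f t l ->
  f (t + h) @[h --> admissible_step t] --> f t.
Proof.
move=> fl; have : f t + h * (h^-1 * (f (t + h) - f t)) @[h --> admissible_step t]
    --> f t + 0 * l.
  by apply: cvgD; [exact: cvg_cst|apply: cvgM => //; exact: admissible_step_cvg0].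
rewrite mul0r addr0; apply: cvg_trans; apply: near_eq_cvg.
near=> h; rewrite mulrA divff ?mul1r ?subrKC //.
near: h; exact: admissible_step_neq0.
Unshelve. all: by end_near. Qed.

Lemma half_line_derive_cst k t : half_line_derive (fun=> k) t 0.
Proof.
rewrite /half_line_derive; under eq_fun do rewrite subrr mulr0.
exact: cvg_cst.
Qed.

Lemma half_line_deriveD f g t l k : half_line_derive f t l ->
  half_line_derive g t k -> half_line_derive (fun s => f s + g s) t (l + k).
Proof.
move=> fl gk; rewrite /half_line_derive.
have -> : (fun h => h^-1 * (f (t + h) + g (t + h) - (f t + g t))) =
    (fun h => h^-1 * (f (t + h) - f t) + h^-1 * (g (t + h) - g t)).
  by apply/funext => h; ring.
exact: cvgD.
Qed.

Lemma half_line_deriveM f g t l k : half_line_derive f t l ->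
  half_line_derive g t k ->
  half_line_derive (fun s => f s * g s) t (l * g t + f t * k).
Proof.
move=> fl gk; rewrite /half_line_derive.
have -> : (fun h => h^-1 * (f (t + h) * g (t + h) - f t * g t)) =
    (fun h => (h^-1 * (f (t + h) - f t)) * g (t + h)
              + f t * (h^-1 * (g (t + h) - g t))).
  by apply/funext => h; ring.
apply: cvgD; apply: cvgM => //.
  exact: half_line_derive_continuous gk.
exact: cvg_cst.
Qed.

Lemma half_line_derive_sum n (f : 'I_n -> R -> R) t (l : 'I_n -> R) :
  (forall i, half_line_derive (f i) t (l i)) ->
  half_line_derive (fun s => \sum_i f i s) t (\sum_i l i).
Proof.
move=> fl; elim: n => [|n IHn] in f l fl *.
  under eq_fun do rewrite big_ord0.
  by rewrite big_ord0; exact: half_line_derive_cst.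
under eq_fun do rewrite big_ord_recr /=.
rewrite big_ord_recr /=; pose w := widen_ord (leqnSn n).
exact: (half_line_deriveD (IHn (fun i => f (w i)) _ (fun i => fl (w i))) (fl _)).
Qed.

Lemma derive_quotientE f t :
  (fun h : R => h^-1 *: ((f \o shift t) (h *: 1) - f t)) =
  (fun h => h^-1 * (f (t + h) - f t)).
Proof. by apply/funext => h /=; rewrite [h *: 1]mulr1 (addrC h). Qed.

Lemma is_derive_half_line f t l : is_derive t 1 f l -> half_line_derive f t l.
Proof.
move=> [df <-]; have := df; rewrite /derivable /derive derive_quotientE => cf.
apply: cvg_within_filter; exact: cf.
Qed.

Lemma half_line_derive_is_derive f t l : 0 < t ->
  half_line_derive f t l -> is_derive t 1 f l.
Proof.
move=> t0 fl; have {}fl : h^-1 * (f (t + h) - f t) @[h --> 0^'] --> l.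
  apply: cvg_trans fl; apply: cvg_app => A.
  rewrite /admissible_step /within /= => tA; near=> h.
  have : 0 <= t + h; last by near: h.
  rewrite -lerBlDl sub0r ltW //; near: h.
  by apply: nbhs_dnbhs; apply: lt_nbhsr; rewrite oppr_lt0.
split; rewrite /derivable /derive derive_quotientE.
  exact: cvgP fl.
exact: cvg_lim fl.
Unshelve. all: by end_near. Qed.

(** The mean value theorem on the open half-line, extended to [0] by one-sided
continuity. *)
Lemma half_line_derive_le0 f f' :
  (forall t, 0 <= t -> half_line_derive f t (f' t)) ->
  (forall t, 0 <= t -> f' t <= 0) -> forall t, 0 <= t -> f t <= f 0.
Proof.
move=> ff' f'0 t t0.
have D (s : R) : 0 < s -> is_derive s 1 f (f' s).
  by move=> s0; apply: half_line_derive_is_derive => //; apply/ff'/ltW.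
have df (s : R) : s \in `]0, +oo[%R -> derivable f s 1.
  by rewrite in_itv /= andbT => /D[].
have df0 (s : R) : s \in `]0, +oo[%R -> derive1 f s <= 0.
  rewrite in_itv /= andbT => s0; rewrite derive1E.
  by have [_ ->] := D s s0; apply/f'0/ltW.
apply: (ler0_derive1_nincry df df0 _ (lexx 0) t0).
apply/continuous_within_itvcyP; split=> [s|].
  rewrite inE => s0.
  by apply/differentiable_continuous/derivable1_diffP/df.
have f0 := half_line_derive_continuous (ff' 0 (lexx 0)).
have {}f0 : f (0 + h) @[h --> (0 : R)^'+] --> f 0.
  apply: cvg_trans f0; apply: cvg_app => A.
  rewrite /admissible_step /at_right /dnbhs /within /=.
  rewrite !nbhs_simpl /= => Anear.
  have : \forall h \near (0 : R), h != 0 -> 0 <= 0 + h -> A h by exact: Anear.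
  move=> hA; suff : \forall h \near (0 : R), 0 < h -> A h by [].
  by apply: (filterS _ hA) => h Ah h0; apply: Ah; rewrite ?gt_eqF // add0r ltW.
by move: f0; rewrite (_ : (fun h => f (0 + h)) = f) //; apply/funext => h; rewrite add0r.
Qed.

End HalfLineDerivative.

(** * Quadratic forms along linear flows *)
Section MatrixCurves.
Context {R : realType}.

Lemma mxdot_mxvec p q (P Q : 'M[R]_(p, q)) : mxdot (mxvec P) (mxvec Q) = mxdot P Q.
Proof.
rewrite /mxdot big_ord1 (reindex _ (curry_mxvec_bij _ _)) /= pair_bigA /=.
by apply: eq_bigr => -[i j] _ /=; rewrite !mxvecE.
Qed.

Lemma entry_le_mx_norm p q (P : 'M[R]_(p, q)) i j : `|P i j| <= `|P|.
Proof.
have -> : `|P| = \big[Num.max/0]_ij `|P ij.1 ij.2| by exact: mx_normrE.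
exact: (le_bigmax _ (fun ij : 'I_p * 'I_q => `|P ij.1 ij.2|) (i, j)).
Qed.

Lemma mx_norm_le_entries p q (P : 'M[R]_(p, q)) c : 0 <= c ->
  (forall i j, `|P i j| <= c) -> `|P| <= c.
Proof.
move=> c0 Pc; have [-> //|P0] := eqVneq `|P| 0.
by have [ij ->] : exists ij, `|P| = `|P ij.1 ij.2| by exact: (mx_norm_neq0 P0).
Qed.

Lemma sqr_mx_norm_le p q (P : 'M[R]_(p, q)) : `|P| ^+ 2 <= mxdot P P.
Proof.
have [P0|P0] := eqVneq `|P| 0; first by rewrite P0 expr0n mxdot_ge0.
have [ij Pij] : exists ij, `|P| = `|P ij.1 ij.2| by exact: (mx_norm_neq0 P0).
by rewrite Pij real_normK ?num_real // sqr_entry_le_mxdot.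
Qed.

Lemma mxdot_le_sqr_mx_norm p q (P : 'M[R]_(p, q)) :
  mxdot P P <= (p * q)%:R * `|P| ^+ 2.
Proof.
have -> : (p * q)%:R * `|P| ^+ 2 = \sum_(i < p) \sum_(j < q) `|P| ^+ 2.
  by rewrite !sumr_const !card_ord -mulrnA mulnC mulr_natl.
apply: ler_sum => i _; apply: ler_sum => j _.
rewrite -expr2 -real_normK ?num_real // lerXn2r ?nnegrE //.
exact: entry_le_mx_norm.
Qed.

Definition mx_half_line_derive p q (u : R -> 'M[R]_(p, q)) t (l : 'M[R]_(p, q)) :=
  forall i j, half_line_derive (fun s => u s i j) t (l i j).

Lemma is_solution_half_line_derive p q (phi : 'M[R]_(p, q) -> 'M[R]_(p, q)) x t :
  is_solution phi x -> 0 <= t -> mx_half_line_derive x t (phi (x t)).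
Proof.
move=> sol t0 i j; have := sol t t0.
move=> /(continuous_cvg _ (@coord_continuous _ _ _ i j _)) dx.
rewrite /half_line_derive; have -> : (fun h => h^-1 * (x (t + h) i j - x t i j)) =
    (fun h => (h^-1 *: (x (t + h) - x t)) i j).
  by apply/funext => h; rewrite !mxE.
exact: dx.
Qed.

Lemma mx_half_line_derive_mxvec p q (u : R -> 'M[R]_(p, q)) t l :
  mx_half_line_derive u t l -> mx_half_line_derive (fun s => mxvec (u s)) t (mxvec l).
Proof.
move=> ul i k; rewrite (ord1 i); case/mxvec_indexP: k => i' j'.
by under eq_fun do rewrite mxvecE; rewrite mxvecE; apply: ul.
Qed.

Lemma mx_half_line_deriveB_cst p q (u : R -> 'M[R]_(p, q)) c t l :
  mx_half_line_derive u t l -> mx_half_line_derive (fun s => u s - c) t l.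
Proof.
move=> ul i j; rewrite -[l i j]addr0; under eq_fun do rewrite !mxE.
exact: half_line_deriveD (ul i j) (half_line_derive_cst (- c i j) t).
Qed.

Lemma mx_half_line_derive_mulmxr p q s (u : R -> 'M[R]_(p, q)) (F : 'M[R]_(q, s)) t l :
  mx_half_line_derive u t l ->
  mx_half_line_derive (fun s => u s *m F) t (l *m F).
Proof.
move=> ul i j; under eq_fun do rewrite mxE.
rewrite mxE; apply: (@half_line_derive_sum _ _ (fun k s => u s i k * F k j)) => k.
rewrite -[l i k * _]addr0 -(mulr0 (u t i k)).
exact: half_line_deriveM (ul i k) (half_line_derive_cst _ t).
Qed.

Lemma half_line_derive_mxdot p q (u v : R -> 'M[R]_(p, q)) t l k :
  mx_half_line_derive u t l -> mx_half_line_derive v t k ->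
  half_line_derive (fun s => mxdot (u s) (v s)) t (mxdot l (v t) + mxdot (u t) k).
Proof.
move=> ul vk; rewrite /mxdot -big_split.
apply: (@half_line_derive_sum _ _ (fun i s => \sum_j u s i j * v s i j)) => i /=.
rewrite -big_split.
apply: (@half_line_derive_sum _ _ (fun j s => u s i j * v s i j)) => j /=.
exact: half_line_deriveM.
Qed.

(** Gronwall's lemma: the function [qform Q (x t) e^(l t)] has a nonpositive
derivative. *)
Lemma qform_decay d (M Q : 'M[R]_d) (x : R -> 'rV[R]_d) l :
  (forall t, 0 <= t -> mx_half_line_derive x t (x t *m M)) ->
  (forall t, 0 <= t -> qform_dot M Q (x t) <= - l * qform Q (x t)) ->
  forall t, 0 <= t -> qform Q (x t) <= qform Q (x 0) * expR (- (l * t)).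
Proof.
move=> dx decay t t0.
have expl s : half_line_derive (fun s => expR (l * s)) s (l * expR (l * s)).
  apply: is_derive_half_line; rewrite mulrC.
  apply: (@is_derive1_comp _ expR (fun s => l * s)).
  by rewrite -[X in is_derive _ _ _ X]mulr1; apply: is_deriveZ.
have D s : 0 <= s -> half_line_derive (fun s => qform Q (x s) * expR (l * s)) s
    (qform_dot M Q (x s) * expR (l * s) + qform Q (x s) * (l * expR (l * s))).
  move=> s0; apply: half_line_deriveM => //; rewrite qform_dotE.
  by apply: half_line_derive_mxdot; [apply: mx_half_line_derive_mulmxr|]; exact: dx.
have := half_line_derive_le0 D _ t0.
rewrite mulr0 expR0 mulr1 expRN -ler_pdivlMr ?expR_gt0 //; apply.
move=> s s0; have := decay s s0; have := expR_gt0 (l * s).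
by set e := expR _; set a := qform_dot _ _ _; set b := qform _ _; nra.
Qed.

End MatrixCurves.

(** * Affine flows with dissipative linear part *)
Section DissipativeFlow.
Context {R : realType} (p q K : nat) (f : {linear 'M[R]_(p, q) -> 'M[R]_(p, q)}).
Context (b : 'M[R]_(p, q)) (phi : 'M[R]_(p, q) -> 'M[R]_(p, q)).
Implicit Types (X : 'M[R]_(p, q)) (P : R -> 'M[R]_(p, q)).
Hypothesis phiE : forall X, phi X = f X + b.
Hypothesis dissipative : forall X, mxdot (f X) X <= 0.
Hypothesis observable : forall X,
  (forall k, (k <= K)%N -> mxdot (f (iter k f X)) (iter k f X) = 0) ->
  iter K f X = 0.
Hypothesis b_orth : forall X, f X = 0 -> mxdot b X = 0.

Let M : 'M[R]_(p * q) := lin_mx f.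

Let mulM x : x *m M = mxvec (f (vec_mx x)).
Proof. by rewrite -mul_vec_lin vec_mxK. Qed.

Let dissipativeM (x : 'rV_(p * q)) : mxdot (x *m M) x <= 0.
Proof. by rewrite mulM -[X in mxdot _ X]vec_mxK mxdot_mxvec. Qed.

Let mulM_exp k x : x *m M ^+ k = mxvec (iter k f (vec_mx x)).
Proof.
elim: k => [|k IHk]; first by rewrite expr0 mulmx1 vec_mxK.
by rewrite exprSr -mulmxE mulmxA IHk mulM mxvecK.
Qed.

Let observableM (x : 'rV_(p * q)) :
  (forall k, (k <= K)%N -> mxdot (x *m M ^+ k *m M) (x *m M ^+ k) = 0) ->
  x *m M ^+ K = 0.
Proof.
move=> xM; rewrite mulM_exp observable ?linear0 // => k /xM.
by rewrite mulM mulM_exp mxvecK mxdot_mxvec.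
Qed.

Lemma dissipative_equilibrium : exists X, is_equilibrium phi X.
Proof.
have [|y yM] := dissipative_range dissipativeM (b := mxvec b).
  move=> x; rewrite mulM => fx0.
  have {}fx0 : f (vec_mx x) = 0 by apply: (can_inj mxvecK); rewrite fx0 linear0.
  by rewrite -[x]vec_mxK mxdot_mxvec b_orth.
exists (- vec_mx y); rewrite /is_equilibrium phiE linearN /=.
by apply: (can_inj mxvecK); rewrite linearD linearN /= -mulM yM addNr linear0.
Qed.

(** Vectorizing the error turns the affine flow into [y' = y M]. *)
Lemma error_derive P Xe : is_equilibrium phi Xe -> is_solution phi P ->
  forall t, 0 <= t ->
  mx_half_line_derive (fun s => mxvec (P s - Xe)) t (mxvec (P t - Xe) *m M).
Proof.
move=> eqX solP t t0; rewrite mulM mxvecK.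
have -> : f (P t - Xe) = phi (P t).
  by rewrite linearB /= -[RHS]subr0 -[X in _ = _ - X]eqX !phiE opprD addrACA subrr addr0.
apply: mx_half_line_derive_mxvec; apply: mx_half_line_deriveB_cst.
exact: is_solution_half_line_derive.
Qed.

(** The Euclidean distance to an equilibrium decreases; the constant compares it
with the maximum norm. *)
Lemma dissipative_lyapunov_stable Xe : is_equilibrium phi Xe -> lyapunov_stable phi Xe.
Proof.
move=> eqX eps eps0; pose c := Num.sqrt ((p * q)%:R + 1 : R).
have c0 : 0 < c by rewrite sqrtr_gt0 ltr_wpDl.
exists (eps / c) => [|P solP P0 t t0]; first by rewrite divr_gt0.
have := qform_decay (Q := 1%:M) (l := 0) (error_derive eqX solP) _ t0.
rewrite mul0r oppr0 expR0 mulr1 /qform !mulmx1 !mxdot_mxvec => decay.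
have {}decay : mxdot (P t - Xe) (P t - Xe) <= mxdot (P 0 - Xe) (P 0 - Xe).
  apply: decay => s s0; rewrite mul0r qform_dotE !mulmx1.
  by rewrite (mxdotC (mxvec _)) -mulr2n mulrn_wle0.
rewrite -(ltr_pXn2r (n := 2)) ?nnegrE // ?(ltW eps0) //.
apply: le_lt_trans (sqr_mx_norm_le _) _; apply: le_lt_trans decay _.
apply: le_lt_trans (mxdot_le_sqr_mx_norm _) _.
have : `|P 0 - Xe| ^+ 2 < (eps / c) ^+ 2.
  by rewrite ltr_pXn2r ?nnegrE // divr_ge0 // ltW.
rewrite expr_div_n sqr_sqrtr ?addr_ge0 //.
rewrite ltr_pdivlMr ?ltr_wpDl // => /(le_lt_trans _); apply.
by rewrite mulrC ler_wpM2l ?sqr_ge0 // lerDl.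
Qed.

(** The limit is the equilibrium whose difference with [P 0] lies in the range
of the linear part, where the strict Lyapunov form decays. *)
Lemma dissipative_converges_exponentially P : is_solution phi P ->
  exists2 Xe, is_equilibrium phi Xe & converges_exponentially P Xe.
Proof.
move=> solP; have [X0 eqX0] := dissipative_equilibrium.
have [u uM [z Pu]] := dissipative_ker_add_range dissipativeM (mxvec (P 0 - X0)).
pose Xe := X0 + vec_mx u.
have eqX : is_equilibrium phi Xe.
  rewrite /is_equilibrium phiE linearD /= addrAC -phiE eqX0 add0r.
  by apply: (can_inj mxvecK); rewrite -mulM uM linear0.
exists Xe => //; pose y t := mxvec (P t - Xe).
have dy : forall t, 0 <= t -> mx_half_line_derive y t (y t *m M).
  exact: error_derive.
have y0 : y 0 = z *m M.
  by rewrite /y /Xe opprD addrA linearB /= Pu vec_mxK addrAC subrr add0r.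
(* The component of [y] in the cokernel of [M] is conserved and starts at 0. *)
have range t : 0 <= t -> exists w, y t = w *m M.
  move=> t0; suff : (y t <= M)%MS by move=> /submxP.
  rewrite submxE; apply/eqP/mxdot_eq0.
  have := qform_decay (Q := cokermx M *m (cokermx M)^T) (l := 0) dy _ t0.
  have QE (v w : 'rV_(p * q)) : mxdot (v *m (cokermx M *m (cokermx M)^T)) w =
      mxdot (v *m cokermx M) (w *m cokermx M).
    by rewrite mulmxA mxdot_mulmxr trmxK.
  rewrite mul0r oppr0 expR0 mulr1 /qform !QE y0 -(mulmxA z) mulmx_coker mulmx0 mxdot0l.
  apply=> s s0; rewrite mul0r qform_dotE !QE -(mulmxA (y s)) mulmx_coker mulmx0.
  by rewrite mxdot0l mxdot0r addr0.
have [Q [l l0 [Qge Qdot]]] := strict_lyapunov_form dissipativeM observableM.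
pose V0 := qform Q (y 0).
have V00 : 0 <= V0 by apply: le_trans (Qge _); apply: mxdot_ge0.
exists (Num.sqrt V0), (l / 2); split=> [|t t0]; first by rewrite divr_gt0.
rewrite -(ler_pXn2r (n := 2)) ?nnegrE ?mulr_ge0 ?expR_ge0 ?sqrtr_ge0 //.
apply: le_trans (sqr_mx_norm_le _) _; rewrite -mxdot_mxvec.
apply: le_trans (Qge _) _.
rewrite exprMn sqr_sqrtr // -expRM_natl.
rewrite (_ : 2%:R * - (l / 2 * t) = - (l * t)); last by field.
apply: (qform_decay dy) t0 => s s0; have [w ->] := range s s0; exact: Qdot.
Qed.

End DissipativeFlow.

Section Convergence.
Context {R : realType} {V : normedModType R}.

Lemma converges_exponentially_bounded (x : R -> V) xe :
  converges_exponentially x xe -> bounded_trajectory x.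
Proof.
move=> [c [l [l0 cv]]]; exists (`|xe| + `|c|) => t t0.
rewrite -[x t](subrK xe) (le_trans (ler_normD _ _)) // addrC lerD2l.
apply: le_trans (cv t t0) _; apply: le_trans (ler_norm _) _.
rewrite normrM ler_piMr // ger0_norm ?expR_ge0 // expR_le1 oppr_le0 mulr_ge0 //.
exact: ltW.
Qed.

Lemma converges_exponentially_cvg (x : R -> V) xe :
  converges_exponentially x xe -> x t @[t --> +oo] --> xe.
Proof.
move=> [c [l [l0 cv]]]; apply/cvgrPdist_le => eps eps0.
near=> t.
have t0 : 0 <= t by near: t; apply: nbhs_pinfty_ge; rewrite num_real.
rewrite distrC (le_trans (cv t t0)) //.
have ct : `|c| / (eps * l) <= t by near: t; apply: nbhs_pinfty_ge; rewrite num_real.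
have E : l * t <= expR (l * t).
  by apply: le_trans (expR_ge1Dx _); rewrite lerDr.
rewrite expRN ler_pdivrMr ?expR_gt0 //.
apply: le_trans (ler_norm _) _.
rewrite ler_pdivrMr ?mulr_gt0 // in ct.
apply: le_trans ct _; rewrite mulrC -mulrA ler_pM2l //.
Unshelve. all: by end_near. Qed.
End Convergence.

(** * Graph Laplacians *)
Section Laplacian.
Context {R : realType} (n : nat) (e : rel 'I_n) (a : 'M[R]_n).
Hypothesis e_sym : symmetric e.
Hypothesis adj : is_adjacency_matrix e a.

Lemma adjacency_sym i j : a i j = a j i.
Proof.
have [eij|neij] := boolP (e i j); first by have [/(_ eij)[]] := adj i j.
have [_ ->] := adj i j; rewrite // e_sym in neij.
by have [_ ->] := adj j i.
Qed.

Lemma adjacency_ge0 i j : 0 <= a i j.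
Proof.
have [eij|neij] := boolP (e i j); last by have [_ ->] := adj i j.
by have [/(_ eij)[_ /ltW]] := adj i j.
Qed.

Variables (p q : nat).
Implicit Types (X Y : 'I_n -> 'M[R]_(p, q)).

Definition laplacian X i := \sum_j a i j *: (X i - X j).

(** Symmetrization of the double sum in [i] and [j], which shows at once that the
Laplacian is self-adjoint, nonnegative and orthogonal to constants. *)
Lemma laplacian_mxdot X Y : \sum_i mxdot (laplacian X i) (Y i) =
  2^-1 * \sum_i \sum_j a i j * mxdot (X i - X j) (Y i - Y j).
Proof.
have E : \sum_i mxdot (laplacian X i) (Y i) =
    \sum_i \sum_j a i j * mxdot (X i - X j) (Y i).
  apply: eq_bigr => i _; rewrite mxdot_suml.
  by apply: eq_bigr => j _; rewrite mxdotZl.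
have E' : \sum_i mxdot (laplacian X i) (Y i) =
    \sum_i \sum_j a i j * - mxdot (X i - X j) (Y j).
  rewrite E exchange_big; apply: eq_bigr => i _; apply: eq_bigr => j _.
  by rewrite adjacency_sym -mxdotNl opprB.
have -> : \sum_i \sum_j a i j * mxdot (X i - X j) (Y i - Y j) =
    \sum_i mxdot (laplacian X i) (Y i) + \sum_i mxdot (laplacian X i) (Y i).
  rewrite [X in X + _]E [X in _ + X]E' -big_split; apply: eq_bigr => i _.
  rewrite -big_split; apply: eq_bigr => j _ /=.
  by rewrite -mulrDr -mxdotBr.
by field.
Qed.

Lemma laplacian_self_adjoint X Y :
  \sum_i mxdot (laplacian X i) (Y i) = \sum_i mxdot (laplacian Y i) (X i).
Proof.
rewrite !laplacian_mxdot; congr (_ * _).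
by apply: eq_bigr => i _; apply: eq_bigr => j _; rewrite mxdotC.
Qed.

Lemma laplacian_ge0 X : 0 <= \sum_i mxdot (laplacian X i) (X i).
Proof.
rewrite laplacian_mxdot mulr_ge0 // sumr_ge0 // => i _; rewrite sumr_ge0 // => j _.
by rewrite mulr_ge0 ?adjacency_ge0 ?mxdot_ge0.
Qed.

Lemma laplacian_sum X : \sum_i laplacian X i = 0.
Proof.
apply: mxdot_eq0; rewrite {1}mxdot_suml (laplacian_mxdot _ (fun=> _)).
rewrite big1 ?mulr0 // => i _; rewrite big1 // => j _.
by rewrite subrr mxdot0r mulr0.
Qed.

Hypothesis conn : forall i j : 'I_n, connect e i j.

Lemma laplacian_consensus X : \sum_i mxdot (laplacian X i) (X i) = 0 ->
  forall i j, X i = X j.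
Proof.
rewrite laplacian_mxdot => /eqP; rewrite mulf_eq0 invr_eq0 pnatr_eq0 /=.
have ge0 i j : 0 <= a i j * mxdot (X i - X j) (X i - X j).
  by rewrite mulr_ge0 ?adjacency_ge0 ?mxdot_ge0.
rewrite psumr_eq0 => [/allP H|i _]; last exact: sumr_ge0.
have edge i j : e i j -> X i = X j.
  move=> eij; have := H i (mem_index_enum _); rewrite psumr_eq0 //.
  move=> /allP /(_ j (mem_index_enum _)); rewrite mulf_eq0.
  have [/(_ eij)[_ aij] _] := adj i j; rewrite gt_eqF //= => /eqP X0.
  by apply/eqP; rewrite -subr_eq0; apply/eqP/mxdot_eq0; rewrite X0.
move=> i j; have /connectP[s + ->] := conn i j.
elim: s i => [//|k s IHs] i /= /andP[/edge -> /IHs //].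
Qed.

Lemma laplacian_consensus0 X i : (forall j k, X j = X k) -> laplacian X i = 0.
Proof.
by move=> Xc; rewrite /laplacian big1 // => j _; rewrite (Xc i j) subrr scaler0.
Qed.

End Laplacian.

(** * Linearity of maps assembled from blocks *)

(** These closure rules let the linearity of a long expression be derived by
following its syntax. *)
Section LinearCombinators.
Context {R : realFieldType} (V : lmodType R).

Lemma linear_addf (W : lmodType R) (S T : V -> W) :
  linear S -> linear T -> linear (fun x => S x + T x).
Proof. by move=> lS lT k u v; rewrite lS lT scalerDr addrACA. Qed.

Lemma linear_oppf (W : lmodType R) (T : V -> W) :
  linear T -> linear (fun x => - T x).
Proof. by move=> lT k u v; rewrite lT opprD scalerN. Qed.

Lemma linear_scalef (W : lmodType R) c (T : V -> W) :
  linear T -> linear (fun x => c *: T x).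
Proof. by move=> lT k u v; rewrite lT scalerDr !scalerA mulrC. Qed.

Lemma linear_sumf (W : lmodType R) n (T : 'I_n -> V -> W) :
  (forall i, linear (T i)) -> linear (fun x => \sum_i T i x).
Proof.
move=> lT k u v; rewrite scaler_sumr -big_split.
by apply: eq_bigr => i _; apply: lT.
Qed.

Lemma linear_mulmxlf p q s (F : 'M[R]_(p, q)) (T : V -> 'M[R]_(q, s)) :
  linear T -> linear (fun x => F *m T x).
Proof. by move=> lT k u v; rewrite lT mulmxDr scalemxAr. Qed.

Lemma linear_mulmxrf p q s (F : 'M[R]_(q, s)) (T : V -> 'M[R]_(p, q)) :
  linear T -> linear (fun x => T x *m F).
Proof. by move=> lT k u v; rewrite lT mulmxDl scalemxAl. Qed.

Lemma linear_mxcolf q n (p_ : 'I_n -> nat) (T : V -> forall i, 'M[R]_(p_ i, q)) :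
  (forall i, linear (T^~ i)) -> linear (fun x => \mxcol_i T x i).
Proof.
move=> lT k u v.
by apply/matrixP => i j; rewrite !mxE lT !mxE.
Qed.

Lemma linear_mxrowf q n (p_ : 'I_n -> nat) (T : V -> forall i, 'M[R]_(q, p_ i)) :
  (forall i, linear (T^~ i)) -> linear (fun x => \mxrow_i T x i).
Proof. by move=> lT k u v; apply/matrixP => i j; rewrite !mxE lT !mxE. Qed.

Lemma linear_col_mxf p1 p2 q (S : V -> 'M[R]_(p1, q)) (T : V -> 'M[R]_(p2, q)) :
  linear S -> linear T -> linear (fun x => col_mx (S x) (T x)).
Proof.
by move=> lS lT k u v; rewrite lS lT -add_col_mx -scale_col_mx.
Qed.

Lemma linear_cst0f (W : lmodType R) : linear (fun _ : V => 0 : W).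
Proof. by move=> k u v; rewrite scaler0 addr0. Qed.

End LinearCombinators.

(** * Augmented blocks and the blocks of a state *)
Section BlockDot.
Context {R : realFieldType}.

Lemma mxdot_vsplit p1 p2 q (P Q : 'M[R]_(p1 + p2, q)) :
  mxdot P Q = mxdot (usubmx P) (usubmx Q) + mxdot (dsubmx P) (dsubmx Q).
Proof. by rewrite -mxdot_col_mx !vsubmxK. Qed.

Lemma mxdot_submxcol q n (p_ : 'I_n -> nat) (P Q : 'M[R]_(\sum_i p_ i, q)) :
  mxdot P Q = \sum_i mxdot (submxcol P i) (submxcol Q i).
Proof. by rewrite -mxdot_mxcol !submxcolK. Qed.

Lemma mxdot_submxrow q n (p_ : 'I_n -> nat) (P Q : 'M[R]_(q, \sum_i p_ i)) :
  mxdot P Q = \sum_i mxdot (submxrow P i) (submxrow Q i).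
Proof. by rewrite -mxdot_mxrow !submxrowK. Qed.

End BlockDot.

Section AugmentedBlocks.
Context {R : realType} {n : nat} (p_ : 'I_n -> nat) (q : nat).

(** In every product with an augmented matrix a single block survives. *)
Lemma big_dfwith (V : nmodType) (T : 'I_n -> nmodType) i (x : T i)
    (g : forall j, T j -> V) : (forall j, g j 0 = 0) ->
  \sum_j g j (eqtype.dfwith (fun j => 0 : T j) x j) = g i x.
Proof.
move=> g0; rewrite (bigD1 i) //= dfwith_in big1 ?addr0 // => j ji.
by rewrite dfwith_out // eq_sym.
Qed.

Lemma aug_col1_mul i (M : 'M[R]_(\sum_j p_ j, q)) :
  aug_col p_ i 1%:M *m M = submxcol M i.
Proof.
rewrite -{1}[M]submxcolK /aug_col mul_mxrow_mxcol.
rewrite (big_dfwith (T := fun j => 'M[R]_(p_ i, p_ j)) _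
  (g := fun j B => B *m submxcol M j)) ?mul1mx // => j.
exact: mul0mx.
Qed.

Lemma mul_aug_row1 i (M : 'M[R]_(q, \sum_j p_ j)) :
  M *m aug_row p_ i 1%:M = submxrow M i.
Proof.
rewrite -{1}[M]submxrowK /aug_row mul_mxrow_mxcol.
rewrite (big_dfwith (T := fun j => 'M[R]_(p_ j, p_ i)) _
  (g := fun j B => submxrow M j *m B)) ?mulmx1 // => j.
exact: mulmx0.
Qed.

Lemma mxdot_aug_row i (M : 'M[R]_(p_ i, q)) N :
  mxdot (aug_row p_ i M) N = mxdot M (submxcol N i).
Proof.
rewrite -{1}[N]submxcolK /aug_row mxdot_mxcol.
rewrite (big_dfwith (T := fun j => 'M[R]_(p_ j, q)) _
  (g := fun j B => mxdot B (submxcol N j))) // => j.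
exact: mxdot0l.
Qed.

Lemma mxdot_aug_col i (M : 'M[R]_(q, p_ i)) N :
  mxdot (aug_col p_ i M) N = mxdot M (submxrow N i).
Proof.
rewrite -{1}[N]submxrowK /aug_col mxdot_mxrow.
rewrite (big_dfwith (T := fun j => 'M[R]_(q, p_ j)) _
  (g := fun j B => mxdot B (submxrow N j))) // => j.
exact: mxdot0l.
Qed.

Lemma aug_row_sum (M : 'M[R]_(\sum_j p_ j, q)) :
  \sum_i aug_row p_ i (submxcol M i) = M.
Proof.
apply/eqP; rewrite -subr_eq0; apply/eqP/mxdot_eq0.
set N := (X in mxdot X X); rewrite mxdotBl mxdot_suml mxdot_submxcol.
by rewrite (eq_bigr _ (fun i _ => mxdot_aug_row (submxcol M i) N)) subrr.
Qed.

Lemma aug_col_sum (M : 'M[R]_(q, \sum_j p_ j)) :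
  \sum_i aug_col p_ i (submxrow M i) = M.
Proof.
apply/eqP; rewrite -subr_eq0; apply/eqP/mxdot_eq0.
set N := (X in mxdot X X); rewrite mxdotBl mxdot_suml mxdot_submxrow.
by rewrite (eq_bigr _ (fun i _ => mxdot_aug_col (submxrow M i) N)) subrr.
Qed.

Lemma linear_aug_rowf (V : lmodType R) i (T : V -> 'M[R]_(p_ i, q)) :
  linear T -> linear (fun x => aug_row p_ i (T x)).
Proof.
move=> lT; apply: linear_mxcolf => j k u v /=; have [<-|ij] := eqVneq i j.
  by rewrite !dfwith_in lT.
by rewrite !dfwith_out // scaler0 addr0.
Qed.

Lemma linear_aug_colf (V : lmodType R) i (T : V -> 'M[R]_(q, p_ i)) :
  linear T -> linear (fun x => aug_col p_ i (T x)).
Proof.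
move=> lT; apply: linear_mxrowf => j k u v /=; have [<-|ij] := eqVneq i j.
  by rewrite !dfwith_in lT.
by rewrite !dfwith_out // scaler0 addr0.
Qed.

End AugmentedBlocks.

Section StateBlocks.
Context {R : realType} {n : nat} (mi ri : 'I_n -> nat).

Local Notation m := (\sum_(i < n) mi i)%N.
Local Notation r := (\sum_(i < n) ri i)%N.
Local Notation nm := (\sum_(i < n) m)%N.
Local Notation state := 'M[R]_(state_rows mi, r).

Section Pack.
Variables (X W L T : 'M[R]_(nm, r)) (Y Z U : 'M[R]_(m, r)) (i : 'I_n).
Let P : state := pack_state X Y Z W L U T.

Lemma block_X_pack : block_X P i = @submxcol _ n (fun=> m) r X i.
Proof. by rewrite /block_X /P /pack_state col_mxKu. Qed.
Lemma block_Y_pack : block_Y P i = submxcol Y i.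
Proof. by rewrite /block_Y /P /pack_state col_mxKd col_mxKu. Qed.
Lemma block_Z_pack : block_Z P i = submxrow Z i.
Proof. by rewrite /block_Z /P /pack_state !col_mxKd col_mxKu. Qed.
Lemma block_W_pack : block_W P i = @submxcol _ n (fun=> m) r W i.
Proof. by rewrite /block_W /P /pack_state !col_mxKd col_mxKu. Qed.
Lemma block_Lambda_pack : block_Lambda P i = @submxcol _ n (fun=> m) r L i.
Proof. by rewrite /block_Lambda /P /pack_state !col_mxKd col_mxKu. Qed.
Lemma block_Upsilon_pack : block_Upsilon P i = submxcol U i.
Proof. by rewrite /block_Upsilon /P /pack_state !col_mxKd col_mxKu. Qed.
Lemma block_Theta_pack : block_Theta P i = @submxcol _ n (fun=> m) r T i.
Proof. by rewrite /block_Theta /P /pack_state !col_mxKd. Qed.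
End Pack.

Lemma state_mxdot (P Q : state) : mxdot P Q = \sum_i
  (mxdot (block_X P i) (block_X Q i) + mxdot (block_Y P i) (block_Y Q i)
   + mxdot (block_Z P i) (block_Z Q i) + mxdot (block_W P i) (block_W Q i)
   + mxdot (block_Lambda P i) (block_Lambda Q i)
   + mxdot (block_Upsilon P i) (block_Upsilon Q i)
   + mxdot (block_Theta P i) (block_Theta Q i)).
Proof.
rewrite !big_split /= /block_X /block_Y /block_Z /block_W /block_Lambda.
rewrite /block_Upsilon /block_Theta.
rewrite -!mxdot_submxcol -mxdot_submxrow.
rewrite [LHS](@mxdot_vsplit _ nm (m + (m + (nm + (nm + (m + nm))))) r P Q).
by do 5!rewrite [X in _ + X = _]mxdot_vsplit ?addrA.
Qed.
End StateBlocks.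

(** * The Sylvester field is affine *)
Section SylvesterFlow.
Context {R : realType} {n : nat} (mi ri : 'I_n -> nat).

Local Notation m := (\sum_(i < n) mi i)%N.
Local Notation r := (\sum_(i < n) ri i)%N.
Local Notation nm := (\sum_(i < n) m)%N.
Local Notation state := 'M[R]_(state_rows mi, r).

Variables (a : 'M[R]_n) (A : 'M[R]_m) (B : 'M[R]_r) (C : 'M[R]_(m, r)).

Let A_ i := submxcol A i.
Let B_ i := submxrow B i.
Let C_ i := submxrow C i.
Let phi := sylvester_field a A B C.

Section FieldBlocks.
Variables (P : state) (i : 'I_n).
Let G := block_X P i *m B_ i - C_ i + block_Z P i.
Let H := A_ i *m block_X P i - block_Y P i.

Lemma block_X_field : block_X (phi P) i =
  - (G *m (B_ i)^T) - (A_ i)^T *m H - (A_ i)^T *m block_Upsilon P i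
  - laplacian a (block_Lambda P) i - laplacian a (block_X P) i.
Proof. by rewrite block_X_pack mxcolK. Qed.

Lemma block_Y_field : block_Y (phi P) i =
  block_Upsilon P i - submxcol (block_Theta P i) i + H.
Proof. by rewrite block_Y_pack mxcolK aug_col1_mul -addrA. Qed.

Lemma block_Z_field : block_Z (phi P) i = - G + submxrow (block_Theta P i) i.
Proof. by rewrite block_Z_pack mxrowK mul_aug_row1. Qed.

Lemma block_W_field : block_W (phi P) i = laplacian a (block_Theta P) i.
Proof. by rewrite block_W_pack mxcolK. Qed.

Lemma block_Lambda_field : block_Lambda (phi P) i = laplacian a (block_X P) i.
Proof. by rewrite block_Lambda_pack mxcolK. Qed.

Lemma block_Upsilon_field : block_Upsilon (phi P) i = H.
Proof. by rewrite block_Upsilon_pack mxcolK. Qed.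

Lemma block_Theta_field : block_Theta (phi P) i =
  aug_row mi i (block_Y P i) - aug_col ri i (block_Z P i)
  - laplacian a (block_W P) i - laplacian a (block_Theta P) i.
Proof. by rewrite block_Theta_pack mxcolK. Qed.

End FieldBlocks.

Definition sylvester_forcing : state :=
  pack_state (\mxcol_(i < n) (C_ i *m (B_ i)^T)) 0 C 0 0 0 0.

Lemma sylvester_field_affine (P : state) :
  phi P = sylvester_field a A B 0 P + sylvester_forcing.
Proof.
rewrite /phi /sylvester_field /sylvester_forcing /pack_state.
rewrite !add_col_mx !addr0; congr col_mx.
  rewrite -mxcolD; apply: eq_mxcol => i; rewrite submxrow0 subr0.
  rewrite (addrAC (_ *m _) (- _)) mulmxBl opprD opprK.
  by rewrite !(addrAC _ (submxrow C i *m _)).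
congr col_mx; congr col_mx.
rewrite -{2}[C]submxrowK -mxrowD; apply: eq_mxrow => i.
rewrite submxrow0 subr0 (addrAC (_ *m _) (- _)) opprD opprK.
by rewrite addrAC.
Qed.

Lemma sylvester_field0_linear :
  linear (sylvester_field a A B 0 : state -> state).
Proof.
have B0 i : linear (fun _ : state => submxrow (0 : 'M[R]_(m, r)) i).
  by rewrite submxrow0; apply: linear_cst0f.
rewrite /sylvester_field /pack_state.
repeat (apply: linear_col_mxf || (apply: linear_mxcolf => i)
  || (apply: linear_mxrowf => i) || apply: linear_addf || apply: linear_oppf
  || (apply: linear_sumf => j) || apply: linear_scalef
  || apply: linear_mulmxlf || apply: linear_mulmxrf
  || apply: linear_aug_rowf || apply: linear_aug_colf || apply: B0).
all: by move=> k u v; apply/matrixP => s t; rewrite !mxE.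
Qed.

HB.instance Definition _ := GRing.isLinear.Build R state state *:%R
  (sylvester_field a A B 0 : state -> state) sylvester_field0_linear.

End SylvesterFlow.

(** * Least squares and the normal equation *)

Section LeastSquares.
Context {R : realType}.

Lemma frobenius_norm_sqr p q (M : 'M[R]_(p, q)) : frobenius_norm M ^+ 2 = mxdot M M.
Proof.
rewrite /frobenius_norm sqr_sqrtr; first by [].
exact: mxdot_ge0.
Qed.

(** The cross term [2 <E, A D + D B>] in the expansion of the residual at
[X + D] is twice the pairing of [D] with the left-hand side of the normal
equation. *)
Lemma normal_equation_least_squares m r (A : 'M[R]_m) (B : 'M[R]_r)
    (C X : 'M[R]_(m, r)) :
  A^T *m (A *m X + X *m B - C) + (A *m X + X *m B - C) *m B^T = 0 ->
  is_least_squares_sylvester A B C X.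
Proof.
set E := A *m X + X *m B - C => normal X'; rewrite !frobenius_norm_sqr -/E.
pose D := X' - X; pose F := A *m D + D *m B.
have -> : A *m X' + X' *m B - C = E + F.
  rewrite /E /F -[X' in LHS](subrKC X) -/D mulmxDr mulmxDl.
  by rewrite (addrACA (A *m X)) (addrAC _ (A *m D + D *m B)).
have EF : mxdot E F = 0.
  rewrite mxdotDr !(mxdotC E) mxdot_mulmxl mxdot_mulmxr -mxdotDr.
  by rewrite normal mxdot0r.
by clearbody E F; rewrite mxdotDl !mxdotDr (mxdotC F E) EF !addr0 add0r lerDl mxdot_ge0.
Qed.

End LeastSquares.

(** * Energy, observability and equilibria of the Sylvester field *)
Section SylvesterDissipativity.
Context {R : realType} {n : nat} (mi ri : 'I_n -> nat).

Local Notation m := (\sum_(i < n) mi i)%N.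
Local Notation r := (\sum_(i < n) ri i)%N.
Local Notation nm := (\sum_(i < n) m)%N.
Local Notation state := 'M[R]_(state_rows mi, r).

Variables (e : rel 'I_n) (a : 'M[R]_n) (A : 'M[R]_m) (B : 'M[R]_r).
Hypothesis e_sym : symmetric e.
Hypothesis adj : is_adjacency_matrix e a.
Hypothesis conn : forall i j : 'I_n, connect e i j.

Let A_ i := submxcol A i.
Let B_ i := submxrow B i.
Let f : state -> state := sylvester_field a A B 0.

Let G (P : state) i := block_X P i *m B_ i + block_Z P i.
Let H (P : state) i := A_ i *m block_X P i - block_Y P i.

(** At each node, the couplings of Upsilon with X and Y and of Theta with Y and
Z appear twice with opposite signs.  The couplings of Lambda with X and of W
with Theta cancel only after summation, by self-adjointness of the Laplacian. *)
Lemma sylvester_energy P : mxdot (f P) P =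
  - (\sum_i mxdot (G P i) (G P i) + \sum_i mxdot (H P i) (H P i)
     + \sum_i mxdot (laplacian a (block_X P) i) (block_X P i)
     + \sum_i mxdot (laplacian a (block_Theta P) i) (block_Theta P i)).
Proof.
have -> : mxdot (f P) P = \sum_i (
   (- mxdot (G P i) (G P i) - mxdot (H P i) (H P i)
    - mxdot (laplacian a (block_X P) i) (block_X P i)
    - mxdot (laplacian a (block_Theta P) i) (block_Theta P i))
   + (mxdot (laplacian a (block_X P) i) (block_Lambda P i)
      - mxdot (laplacian a (block_Lambda P) i) (block_X P i))
   + (mxdot (laplacian a (block_Theta P) i) (block_W P i)
      - mxdot (laplacian a (block_W P) i) (block_Theta P i))).
  rewrite state_mxdot; apply: eq_bigr => i _.
  rewrite block_X_field block_Y_field block_Z_field block_W_field.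
  rewrite block_Lambda_field block_Upsilon_field block_Theta_field.
  rewrite submxrow0 subr0 -/(G P i) -/(H P i).
  rewrite !mxdotBl !mxdotDl !mxdotNl.
  rewrite !mxdot_aug_row !mxdot_aug_col.
  rewrite (mxdot_mulmxr (G P i)) trmxK !(mxdot_mulmxl (A_ i)^T) trmxK.
  rewrite (mxdotC (submxcol (block_Theta P i) i)).
  rewrite (mxdotC (submxrow (block_Theta P i) i)).
  rewrite [in RHS]/G [in RHS]/H !mxdotDr !mxdotNr (mxdotC (block_Upsilon P i)).
  rewrite (mxdotC (block_Upsilon P i)).
  rewrite {1}/H !mxdotBl.
  by rewrite /G /B_ !mxdotDl; ring.
rewrite !big_split /= !sumrN.
rewrite (laplacian_self_adjoint e_sym adj (block_Lambda P)).
rewrite (laplacian_self_adjoint e_sym adj (block_W P)).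
rewrite !subrr !addr0 !opprD; ring.
Qed.

Lemma sylvester_dissipative P : mxdot (f P) P <= 0.
Proof.
rewrite sylvester_energy oppr_le0.
by do !apply: addr_ge0; rewrite ?(laplacian_ge0 e_sym adj) //;
  apply: sumr_ge0 => i _; apply: mxdot_ge0.
Qed.

Lemma sylvester_energy_eq0 P : mxdot (f P) P = 0 ->
  [/\ forall i, G P i = 0, forall i, H P i = 0,
      forall i, laplacian a (block_X P) i = 0
    & forall i, laplacian a (block_Theta P) i = 0].
Proof.
rewrite sylvester_energy.
have := laplacian_ge0 e_sym adj (block_X P).
have := laplacian_ge0 e_sym adj (block_Theta P).
have : 0 <= \sum_i mxdot (G P i) (G P i) by apply: sumr_ge0 => i _; apply: mxdot_ge0.
have : 0 <= \sum_i mxdot (H P i) (H P i) by apply: sumr_ge0 => i _; apply: mxdot_ge0.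
set g := \sum_i mxdot (G P i) _; set h := \sum_i mxdot (H P i) _.
set x := \sum_i mxdot (laplacian a (block_X P) i) _.
set t := \sum_i mxdot (laplacian a (block_Theta P) i) _.
move=> h0 g0 t0 x0 sum0; split=> i.
- by apply: sum_mxdot_eq0; rewrite -/g; lra.
- by apply: sum_mxdot_eq0; rewrite -/h; lra.
- apply: laplacian_consensus0; apply: (laplacian_consensus e_sym adj conn).
  by rewrite -/x; lra.
- apply: laplacian_consensus0; apply: (laplacian_consensus e_sym adj conn).
  by rewrite -/t; lra.
Qed.

(** Zero energy means [X_i B_i + Z_i = 0], [A_i X_i = Y_i] and consensus of X and
Theta.  It makes W, Lambda and Upsilon vanish in the derivative, hence X vanish
in the second derivative if the first one has zero energy as well; the
constraints then remove Y and Z, and Theta disappears one derivative later. *)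
Lemma sylvester_observable P :
  (forall k, (k <= 3)%N -> mxdot (f (iter k f P)) (iter k f P) = 0) ->
  iter 3 f P = 0.
Proof.
move=> energy0; rewrite [iter 3 f P]/(f (f (f P))).
have [G0 H0 X0 T0] := sylvester_energy_eq0 (energy0 0%N isT : mxdot (f P) P = 0).
have [G1 H1 X1 T1] :=
  sylvester_energy_eq0 (energy0 1%N isT : mxdot (f (f P)) (f P) = 0).
have [G2 H2 X2 T2] :=
  sylvester_energy_eq0 (energy0 2%N isT : mxdot (f (f (f P))) (f (f P)) = 0).
have [G3 H3 _ _] :=
  sylvester_energy_eq0 (energy0 3%N isT : mxdot (f (f (f (f P)))) (f (f (f P))) = 0).
have conserved Q : (forall i, H Q i = 0) -> (forall i, laplacian a (block_X Q) i = 0) ->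
    (forall i, laplacian a (block_Theta Q) i = 0) -> forall i,
    [/\ block_W (f Q) i = 0, block_Lambda (f Q) i = 0 & block_Upsilon (f Q) i = 0].
  move=> HQ XQ TQ i; split; first by rewrite block_W_field.
    by rewrite block_Lambda_field.
  by rewrite block_Upsilon_field; apply: HQ.
have X_next Q : (forall i, G Q i = 0) -> (forall i, H Q i = 0) ->
    (forall i, laplacian a (block_X Q) i = 0) -> (forall i, block_Lambda Q i = 0) ->
    (forall i, block_Upsilon Q i = 0) -> forall i, block_X (f Q) i = 0.
  move=> GQ HQ XQ LQ UQ i; rewrite block_X_field submxrow0 subr0 -/(G Q i) -/(H Q i).
  rewrite GQ HQ UQ XQ mul0mx !mulmx0 laplacian_consensus0 ?oppr0 ?addr0 //.
  by move=> j k; rewrite !LQ.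
have YZ Q i : G Q i = 0 -> H Q i = 0 -> block_X Q i = 0 ->
    block_Y Q i = 0 /\ block_Z Q i = 0.
  rewrite /G /H => GQ HQ XQ; move: GQ HQ; rewrite XQ mul0mx mulmx0 add0r sub0r.
  by move=> -> /eqP; rewrite oppr_eq0 => /eqP.
have f1 := conserved _ H0 X0 T0; have f2 := conserved _ H1 X1 T1; have f3 := conserved _ H2 X2 T2.
have X2z := X_next _ G1 H1 X1 (fun i => let: And3 _ l _ := f1 i in l)
  (fun i => let: And3 _ _ u := f1 i in u).
have X3z := X_next _ G2 H2 X2 (fun i => let: And3 _ l _ := f2 i in l)
  (fun i => let: And3 _ _ u := f2 i in u).
have aug0 : forall i, aug_row mi i (0 : 'M[R]_(mi i, r)) = 0 /\
    aug_col ri i (0 : 'M[R]_(m, ri i)) = 0.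
  by move=> i; split; apply: mxdot_eq0; rewrite ?mxdot_aug_row ?mxdot_aug_col mxdot0l.
apply: mxdot_eq0; rewrite state_mxdot big1 // => i _.
have [-> -> ->] := f3 i; have [-> ->] := YZ _ i (G3 i) (H3 i) (X3z i).
rewrite X3z block_Theta_field; have [-> ->] := YZ _ i (G2 i) (H2 i) (X2z i).
have [-> ->] := aug0 i; rewrite T2 laplacian_consensus0 => [|j k].
  by rewrite !subr0 !mxdot0l !addr0.
by have [-> _ _] := f2 j; have [-> _ _] := f2 k.
Qed.

(** Pairing with the forcing gives [sum_i <C_i, X_i B_i + Z_i>], and a kernel
element has zero energy. *)
Lemma sylvester_forcing_orth (C : 'M[R]_(m, r)) P : f P = 0 ->
  mxdot (sylvester_forcing B C) P = 0.
Proof.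
move=> fP; have [|G0 _ _ _] := @sylvester_energy_eq0 P.
  by rewrite fP mxdot0l.
rewrite state_mxdot big1 // => i _.
rewrite block_X_pack block_Y_pack block_Z_pack block_W_pack block_Lambda_pack.
rewrite block_Upsilon_pack block_Theta_pack !submxcol0 !mxdot0l !addr0.
by rewrite mxcolK mxdot_mulmxr trmxK -mxdotDr -/(B_ i) -/(G P i) G0 mxdot0r.
Qed.

(** The common value of Theta is the residual: the Theta equations sum to
[A X = Z], and the Z equations read [X B - C + Z = Theta].  The Y equations make
Upsilon equal to it as well, and the X equations sum to the normal equation. *)
Lemma sylvester_equilibrium_least_squares C P (i0 : 'I_n) :
  is_equilibrium (sylvester_field a A B C) P ->
  (forall i, block_X P i = block_X P i0) /\
  is_least_squares_sylvester A B C (block_X P i0).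
Proof.
rewrite /is_equilibrium => fP0.
have blk0 : forall i, [/\ block_X (0 : state) i = 0, block_Y (0 : state) i = 0 &
    block_Z (0 : state) i = 0] /\ [/\ block_W (0 : state) i = 0,
    block_Lambda (0 : state) i = 0, block_Upsilon (0 : state) i = 0 &
    block_Theta (0 : state) i = 0].
  by move=> i; split; split; apply/matrixP => s t; rewrite !mxE.
have X0 i : laplacian a (block_X P) i = 0.
  by rewrite -(block_Lambda_field a A B C) fP0; have [_ []] := blk0 i.
have T0 i : laplacian a (block_Theta P) i = 0.
  by rewrite -(block_W_field a A B C) fP0; have [_ []] := blk0 i.
have H0 i : H P i = 0.
  have <- : block_Upsilon (sylvester_field a A B C P) i = H P i.
    exact: block_Upsilon_field.
  by rewrite fP0; have [_ []] := blk0 i.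
have Xc : forall i j, block_X P i = block_X P j.
  by apply: (laplacian_consensus e_sym adj conn); rewrite big1 // => i _; rewrite X0 mxdot0l.
have Tc : forall i j, block_Theta P i = block_Theta P j.
  by apply: (laplacian_consensus e_sym adj conn); rewrite big1 // => i _; rewrite T0 mxdot0l.
split=> //; pose X := block_X P i0; pose T := block_Theta P i0.
have Y_eq i : block_Y P i = submxcol (A *m X) i.
  by have /eqP := H0 i; rewrite subr_eq0 (Xc i i0) => /eqP <-; rewrite submxcol_mul.
pose Z := \mxrow_i block_Z P i.
have ZA : A *m X = Z.
  have : \sum_i (aug_row mi i (block_Y P i) - aug_col ri i (block_Z P i)
      - laplacian a (block_W P) i - laplacian a (block_Theta P) i) = 0.
    apply: big1 => i _; rewrite -(block_Theta_field a A B C) fP0.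
    by have [_ []] := blk0 i.
  rewrite !big_split /= !sumrN !(laplacian_sum e_sym adj) oppr0 !addr0.
  have -> : \sum_i aug_row mi i (block_Y P i) = A *m X.
    by rewrite -[RHS]aug_row_sum; apply: eq_bigr => i _; rewrite Y_eq.
  have -> : \sum_i aug_col ri i (block_Z P i) = Z.
    by rewrite -[RHS]aug_col_sum; apply: eq_bigr => i _; rewrite mxrowK.
  by move=> /eqP; rewrite subr_eq0 => /eqP.
have GT i : block_X P i *m submxrow B i - submxrow C i + block_Z P i = submxrow T i.
  have := block_Z_field a A B C P i; rewrite fP0; have [[_ _ ->] _] := blk0 i.
  by move=> /esym /eqP; rewrite addrC subr_eq0 => /eqP <-; rewrite (Tc i i0).
have T_eq : T = A *m X + X *m B - C.
  rewrite ZA -[LHS]submxrowK -[RHS]submxrowK; apply: eq_mxrow => i.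
  rewrite -GT submxrowB submxrowD mxrowK -mul_submxrow (Xc i i0).
  by rewrite addrC addrA.
have U_eq i : block_Upsilon P i = submxcol T i.
  have := block_Y_field a A B C P i; rewrite fP0; have [[_ -> _] _] := blk0 i.
  rewrite -/(H P i) H0 addr0 => /esym /eqP; rewrite subr_eq0 => /eqP ->.
  by rewrite (Tc i i0).
apply: normal_equation_least_squares; rewrite -/X -T_eq.
have : \sum_i (- (submxrow T i *m (submxrow B i)^T)
    - (submxcol A i)^T *m submxcol T i - laplacian a (block_Lambda P) i) = 0.
  apply: big1 => i _; have [[E _ _] _] := blk0 i; rewrite -[RHS]E -[in RHS]fP0.
  by rewrite block_X_field GT -/(H P i) H0 mulmx0 subr0 U_eq X0 subr0.
rewrite !big_split /= !sumrN (laplacian_sum e_sym adj) subr0.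
have -> : \sum_i submxrow T i *m (submxrow B i)^T = T *m B^T.
  by rewrite -mul_mxrow_mxcol -tr_mxrow !submxrowK.
have -> : \sum_i (submxcol A i)^T *m submxcol T i = A^T *m T.
  by rewrite -mul_mxrow_mxcol -tr_mxcol !submxcolK.
by rewrite -opprD addrC => /eqP; rewrite oppr_eq0 => /eqP.
Qed.

Lemma block_X_cvg (T : Type) (F : set_system T) (FF : Filter F) (P : T -> state) Pe i :
  P t @[t --> F] --> Pe -> block_X (P t) i @[t --> F] --> block_X Pe i.
Proof.
move=> /cvgrPdist_le PPe; apply/cvgrPdist_le => eps /PPe.
apply: filterS => t; apply: le_trans.
have -> : block_X Pe i - block_X (P t) i = block_X (Pe - P t) i.
  by apply/matrixP => j k; rewrite !mxE.
apply: mx_norm_le_entries => // j k.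
by rewrite mxE [X in `|X| <= _]mxE; apply: entry_le_mx_norm.
Qed.

End SylvesterDissipativity.

(** * Convergence of the Sylvester flow *)
Theorem theorem1 (R : realType) (n : nat) (hn : (0 < n)%N)
    (e : rel 'I_n) (a : 'M[R]_n)
    (he : symmetric e) (hconn : forall i j : 'I_n, connect e i j)
    (ha : is_adjacency_matrix e a)
    (mi ri : 'I_n -> nat)
    (hmi : forall i, (0 < mi i)%N) (hri : forall i, (0 < ri i)%N)
    (A : 'M[R]_(\sum_(i < n) mi i)) (B : 'M[R]_(\sum_(i < n) ri i))
    (C : 'M[R]_(\sum_(i < n) mi i, \sum_(i < n) ri i)) :
  let phi := sylvester_field a A B C in
  (* (i) *)
  ((forall Pe, is_equilibrium phi Pe -> lyapunov_stable phi Pe) /\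
   (forall P : R -> 'M[R]_(state_rows mi, \sum_(i < n) ri i),
      is_solution phi P -> bounded_trajectory P)) /\
  (* (ii) *)
  (globally_semistable phi /\
   (forall P : R -> 'M[R]_(state_rows mi, \sum_(i < n) ri i),
      is_solution phi P ->
      exists2 Pe, is_equilibrium phi Pe & converges_exponentially P Pe)) /\
  (* (iii) *)
  (forall P : R -> 'M[R]_(state_rows mi, \sum_(i < n) ri i),
      is_solution phi P ->
      exists2 Xstar : 'M[R]_(\sum_(i < n) mi i, \sum_(i < n) ri i),
        forall i : 'I_n, block_X (P t) i @[t --> +oo] --> Xstar
        & is_least_squares_sylvester A B C Xstar).
Proof.
pose state := 'M[R]_(state_rows mi, \sum_(i < n) ri i).
pose f : {linear state -> state} := sylvester_field a A B 0.
move=> phi.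
have phiE (P : state) : phi P = f P + sylvester_forcing B C.
  exact: sylvester_field_affine.
have diss : forall P : state, mxdot (f P) P <= 0.
  exact: sylvester_dissipative he ha.
have obs : forall P : state,
    (forall k, (k <= 3)%N -> mxdot (f (iter k f P)) (iter k f P) = 0) ->
    iter 3 f P = 0.
  exact: sylvester_observable he ha hconn.
have orth : forall P : state, f P = 0 -> mxdot (sylvester_forcing B C) P = 0.
  exact: sylvester_forcing_orth he ha hconn C.
have stable Pe : is_equilibrium phi Pe -> lyapunov_stable phi Pe.
  exact: (dissipative_lyapunov_stable phiE diss).
have conv P : is_solution phi P ->
    exists2 Pe, is_equilibrium phi Pe & converges_exponentially P Pe.
  exact: (dissipative_converges_exponentially phiE diss obs orth).
split; [split=> // P /conv[Pe _]; exact: converges_exponentially_bounded|].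
split; [split=> // P solP|move=> P solP]; have [Pe eqPe cvP] := conv P solP.
  by exists Pe; split; [|exact: stable|exact: converges_exponentially_cvg cvP].
have [Xc ls] := sylvester_equilibrium_least_squares he ha hconn (Ordinal hn) eqPe.
exists (block_X Pe (Ordinal hn)) => // i; rewrite -(Xc i).
have PPe := converges_exponentially_cvg cvP.
exact: block_X_cvg PPe.
Qed.
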